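(* Let $(F_n)_{n\in\mathbb{N}}$ be a sequence of quasi-infinitely divisible distribution functions with spectral pairs $(\gamma_n,G_n)$, $\gamma_n\in\mathbb{R}$, $G_n\in\boldsymbol{V}$, $n\in\mathbb{N}$. Suppose that $\varlimsup_{n\to\infty}\|G_n\|<\infty$. Let $F$ be a quasi-infinitely divisible distribution function with spectral pair $(\gamma,G)$, where $\gamma\in\mathbb{R}$ and $G\in\boldsymbol{V}$. The sequence $(F_n)_{n\in\mathbb{N}}$ weakly converges to $F$ if and only if $(F_n)_{n\in\mathbb{N}}$ is relatively compact and $\gamma_n\to\gamma$, $G_n\Rightarrow G$ (basic convergence), $n\to\infty$. Moreover, the convergence $G_n(+\infty)\to G(+\infty)$, $n\to\infty$, can be added to the necessary conditions (i.e. it also holds whenever $(F_n)_{n\in\mathbb{N}}$ weakly converges to $F$).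
   Context: $\boldsymbol{V}$ denotes the class of all functions $G:\mathbb{R}\to\mathbb{R}$ of bounded variation on $\mathbb{R}$ that are right-continuous at every point and satisfy $G(-\infty)=0$, where $G(\pm\infty)$ denote the limits at $\pm\infty$. For $G\in\boldsymbol{V}$, $\|G\|$ is the total variation of $G$ on $\mathbb{R}$; integrals $\int_{\mathbb{R}} h\,dG$ are with respect to the finite signed Lebesgue--Stieltjes measure $\mu_G$ with $\mu_G((a,b])=G(b)-G(a)$. A number $\tau>0$ is fixed throughout. A (probability) distribution function $F$ on $\mathbb{R}$ is quasi-infinitely divisible if its characteristic function $f(t)=\int_{\mathbb{R}}e^{itx}\,dF(x)$ has the form $$f(t)=\exp\Bigl\{it\gamma+\int_{\mathbb{R}}\Bigl(e^{itx}-1-\tfrac{it}{\tau}\sin(\tau x)\Bigr)\tfrac{1+x^2}{x^2}\,dG(x)\Bigr\},\quad t\in\mathbb{R},$$ with some $\gamma\in\mathbb{R}$ and $G\in\boldsymbol{V}$ (the integrand at $x=0$ is defined by continuity, i.e. equals $-t^2/2$). The pair $(\gamma,G)$ is uniquely determined by $F$ and is called its spectral pair. (The property does not depend on $\tau$; $\gamma$ depends on $\tau$ but $G$ does not. All spectral pairs are taken with the same fixed $\tau$.) Basic convergence: for $G_n,G\in\boldsymbol{V}$, $(G_n)_{n\in\mathbb{N}}$ converges basically to $G$, written $G_n\Rightarrow G$, $n\to\infty$, if every subsequence of $(G_n)_{n\in\mathbb{N}}$ contains a further subsequence $(G_{n_k})_{k\in\mathbb{N}}$ for which there is an at most countable set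 $D\subset\mathbb{R}$ (depending in general on the choice of the subsequences) such that $G_{n_k}(x_2)-G_{n_k}(x_1)\to G(x_2)-G(x_1)$, $k\to\infty$, for all $x_1,x_2\in\mathbb{R}\setminus D$. Weak convergence of $(F_n)$ to $F$ means $\int_{\mathbb{R}}h\,dF_n\to\int_{\mathbb{R}}h\,dF$ for every bounded continuous $h:\mathbb{R}\to\mathbb{R}$. A sequence $(F_n)_{n\in\mathbb{N}}$ of distribution functions is relatively compact if every subsequence contains a further subsequence that weakly converges to a distribution function. *)

(* Defs.v *)
From HB Require Import structures.
From mathcomp Require Import all_boot all_order all_algebra.
From mathcomp Require Import all_classical all_reals all_analysis.
From mathcomp Require Import complex.

Set Implicit Arguments.
Unset Strict Implicit.
Unset Printing Implicit Defensive.
Import Order.TTheory GRing.Theory Num.Theory.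
Import numFieldNormedType.Exports.

Local Open Scope classical_set_scope.
Local Open Scope ring_scope.
Local Open Scope complex_scope.

(* A probability distribution function is an inhabitant of
   [cumulativeBounded (0 : R) (1 : R)]: nondecreasing, right-continuous, with
   limits 0 at -oo and 1 at +oo. *)

Definition total_variationR (R : realType) (G : R -> R) : \bar R :=
  ereal_sup [set total_variation p.1 p.2 G | p in [set p : R * R | p.1 <= p.2]].

Definition classV (R : realType) (G : R -> R) : Prop :=
  [/\ (total_variationR G < +oo)%E,
      right_continuous G &
      G x @[x --> -oo] --> 0].

(* The limit at +oo exists for every function of bounded variation on the
   line, so the total operator [lim] takes no default value on [classV]. *)
Definition limit_pinfty (R : realType) (G : R -> R) : R :=
  lim (G x @[x --> +oo]).

Definition is_stieltjes_charge (R : realType) (G : R -> R)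
    (nu : {charge set (measurableTypeR R) -> \bar R}) : Prop :=
  forall a b : R, a <= b -> nu `]a, b]%classic = (G b - G a)%:E.

(* The integral against a finite signed measure is taken through its Jordan
   decomposition, which does not depend on the chosen Hahn decomposition
   ([Hahn_decomposition_uniq]). *)
Definition charge_Rintegral (R : realType)
    (nu : {charge set (measurableTypeR R) -> \bar R}) (h : R -> R) : R :=
  let P_ := cid (Hahn_decomposition nu) in
  let N_ := cid (projT2 P_) in
  \int[jordan_pos (projT2 N_)]_x h x - \int[jordan_neg (projT2 N_)]_x h x.

(* Extension of a real integration functional to complex-valued functions. *)
Definition cintegral (R : realType) (I : (R -> R) -> R) (h : R -> R[i]) : R[i] :=
  I (fun x => complex.Re (h x)) +i* I (fun x => complex.Im (h x)).

Definition cexp (R : realType) (z : R[i]) : R[i] :=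
  (expR (complex.Re z))%:C * (cos (complex.Im z) +i* sin (complex.Im z)).

Definition char_fun (R : realType) (F : cumulativeBounded (0 : R) (1 : R))
    (t : R) : R[i] :=
  cintegral (fun h => \int[lebesgue_stieltjes_measure F]_x h x)
    (fun x => cexp ('i%C * (t * x)%:C)).

Definition levy_integrand (R : realType) (tau t x : R) : R[i] :=
  if x == 0 then (- (t ^+ 2 / 2))%:C
  else (cexp ('i%C * (t * x)%:C) - 1 - 'i%C * (t / tau * sin (tau * x))%:C)
       * ((1 + x ^+ 2) / x ^+ 2)%:C.

(* [F] is quasi-infinitely divisible when it has some spectral pair.  The
   charge [nu] below exists and is unique for every [G] in the class V. *)
Definition spectral_pair (R : realType) (tau : R)
    (F : cumulativeBounded (0 : R) (1 : R)) (gamma : R) (G : R -> R) : Prop :=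
  classV G /\
  exists2 nu : {charge set (measurableTypeR R) -> \bar R},
    is_stieltjes_charge G nu &
    forall t : R, char_fun F t =
      cexp ('i%C * (t * gamma)%:C
            + cintegral (charge_Rintegral nu) (levy_integrand tau t)).

Definition weak_convergence (R : realType)
    (F_ : nat -> cumulativeBounded (0 : R) (1 : R))
    (F : cumulativeBounded (0 : R) (1 : R)) : Prop :=
  forall h : R -> R, continuous h -> bounded_fun h ->
    \int[lebesgue_stieltjes_measure (F_ n)]_x h x @[n --> \oo]
      --> \int[lebesgue_stieltjes_measure F]_x h x.

(* On [nat], [increasing_seq] means strictly increasing, so such a [phi]
   indexes a subsequence. *)
Definition relatively_compact (R : realType)
    (F_ : nat -> cumulativeBounded (0 : R) (1 : R)) : Prop :=
  forall phi : nat -> nat, increasing_seq phi ->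
    exists2 psi : nat -> nat, increasing_seq psi &
    exists F : cumulativeBounded (0 : R) (1 : R),
      weak_convergence (fun k => F_ (phi (psi k))) F.

Definition basic_convergence (R : realType) (G_ : nat -> R -> R) (G : R -> R)
    : Prop :=
  forall phi : nat -> nat, increasing_seq phi ->
    exists2 psi : nat -> nat, increasing_seq psi &
    exists2 D : set R, countable D &
      forall x1 x2 : R, ~ D x1 -> ~ D x2 ->
        G_ (phi (psi k)) x2 - G_ (phi (psi k)) x1 @[k --> \oo]
          --> G x2 - G x1.

(* Main.v *)
Require Import Defs.
From HB Require Import structures.
From mathcomp Require Import all_boot all_order all_algebra.
From mathcomp Require Import all_classical all_reals all_analysis.
From mathcomp Require Import measurable_realfun.
From mathcomp Require Import complex.
From mathcomp Require Import ring lra.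
Import Order.TTheory GRing.Theory Num.Theory.
Import numFieldNormedType.Exports.
Set Implicit Arguments.
Unset Strict Implicit.
Unset Printing Implicit Defensive.

Local Open Scope classical_set_scope.
Local Open Scope ring_scope.

(** Write [f_n = exp psi_n] for the characteristic functions, with
[psi_n t = i t gamma_n + int (exp (i t x) - 1 - (i t / tau) sin (tau x))
(1 + x ^ 2) / x ^ 2 dG_n].  Two features of the exponent carry the argument.  At
[t = tau] the integrand is real, so that the imaginary part of [psi_n tau] is
[tau gamma_n].  And the second difference [psi_n (t + h) + psi_n (t - h) -
2 psi_n t] removes the drift and the centring: it is minus the Fourier transform
of [G_n] with the bounded weight [2 (1 - cos (h x)) (1 + x ^ 2) / x ^ 2].

The spectral functions enter through vague convergence of their charges, that
is, convergence of integrals of continuous functions of compact support.  As the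
variations are bounded, it is the same as basic convergence: increments off a
countable set give step functions and thus test functions
([vague_of_increments]); conversely Helly's theorem, applied to the distribution
functions of the variation measures, isolates the countably many points near
which variation accumulates, and at the others indicators of intervals are close
to trapezoids ([increments_of_vague]).

Suppose that [F_n] converges weakly to [F].  Characteristic functions of a weakly
convergent sequence are equicontinuous ([char_equicontinuous]); bounded variation
keeps them away from zero on bounded sets, so the exponents are equicontinuous
and converge pointwise ([exponent_convergence]).  The value at [tau] gives the
convergence of the drifts.  The second differences give that of the weighted
Fourier transforms, from which the Fejer kernel recovers integrals of functions
of compact support ([cvg_sint_compact]); division by a weight that does not
vanish on the support gives vague convergence ([vague_convergence_fourier]).
Signed charges of bounded variation need not be tight, so the total mass is
recovered separately, by averaging the weights in [h] ([cvg_total_mass]).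

Conversely, assume relative compactness and the convergence of the spectral data.
Every subsequence has a further one along which [F_n] converges weakly to some
[F0] and the charges converge vaguely.  Weak convergence again gives
equicontinuous exponents.  Vague convergence gives the convergence of averages of
the weighted Fourier transforms over small boxes, as these averages integrate
functions vanishing at infinity, and equicontinuity of the second differences
removes the averaging ([fourier_of_vague]).  Convergence of all the second
differences, together with that at [tau], gives convergence of the exponents
([weak_convergence_of_spectra]).  Hence [F0 = F], and the whole sequence converges
to [F]. *)

(** * Bounded measurable functions and signed measures *)

Section BoundedMeasurable.
Context {R : realType}.
Notation T := (measurableTypeR R).
Notation fmeas := {finite_measure set T -> \bar R}.

Definition bmf (g : R -> R) : Prop :=
  measurable_fun [set: T] (g : T -> R) /\ exists M, forall x, `|g x| <= M.

Lemma bmf_continuous g M : continuous g -> (forall x, `|g x| <= M) -> bmf g.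
Proof.
move=> cg gM; split; last by exists M.
exact: continuous_measurable_fun.
Qed.

Lemma bmf_cst c : bmf (fun=> c).
Proof. by split; [exact: measurable_cst|exists `|c|]. Qed.

Lemma bmfD f g : bmf f -> bmf g -> bmf (fun x => f x + g x).
Proof.
move=> [mf [M fM]] [mg [N gN]]; split; first exact: measurable_funD.
by exists (M + N) => x; rewrite (le_trans (ler_normD _ _))// lerD.
Qed.

Lemma bmfM f g : bmf f -> bmf g -> bmf (fun x => f x * g x).
Proof.
move=> [mf [M fM]] [mg [N gN]]; split; first exact: measurable_funM.
by exists (M * N) => x; rewrite normrM ler_pM.
Qed.

Lemma bmfZ c g : bmf g -> bmf (fun x => c * g x).
Proof. by move=> bg; apply: bmfM => //; exact: bmf_cst. Qed.

Lemma bmfB f g : bmf f -> bmf g -> bmf (fun x => f x - g x).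
Proof.
move=> bf bg.
rewrite (_ : (fun _ => _) = (fun x => f x + (-1) * g x)).
  by apply: bmfD => //; exact: bmfZ.
by apply/funext => x; rewrite mulN1r.
Qed.

Lemma bmf_sum (I : Type) (r : seq I) (f : I -> R -> R) :
  (forall i, bmf (f i)) -> bmf (fun x => \sum_(i <- r) f i x).
Proof.
move=> bf; elim: r => [|i r IH].
  under eq_fun do rewrite big_nil.
  exact: bmf_cst.
under eq_fun do rewrite big_cons.
exact: bmfD.
Qed.

Lemma bmf_indic (A : set R) : measurable (A : set T) -> bmf (\1_A).
Proof.
move=> mA; split; first exact: measurable_indic.
by exists 1 => x; rewrite indicE; case: (_ \in _); rewrite ?normr1 ?normr0.
Qed.

Lemma bmf_integrable (mu : fmeas) g : bmf g -> mu.-integrable setT (EFin \o g).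
Proof.
move=> [mg [M gM]].
apply: (le_integrable measurableT _ _
          (finite_measure_integrable_cst mu M measurableT)).
  exact/measurable_EFinP.
move=> x _ /=; rewrite lee_fin (le_trans (gM x))//; exact: ler_norm.
Qed.

(** A pair of finite measures stands for their difference.  The Jordan
decomposition of a charge is such a pair, and so is a probability measure with
the zero measure, so that both kinds of limit are treated at once. *)
Definition sint (m : fmeas * fmeas) (g : R -> R) : R :=
  \int[m.1]_x g x - \int[m.2]_x g x.

(** An upper bound of the total variation, with equality for a Jordan
decomposition. *)
Definition smass (m : fmeas * fmeas) : R := fine (m.1 setT) + fine (m.2 setT).

Lemma smass_ge0 m : 0 <= smass m.
Proof. by rewrite addr_ge0// fine_ge0. Qed.

Lemma sintD m f g : bmf f -> bmf g ->
  sint m (fun x => f x + g x) = sint m f + sint m g.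
Proof.
move=> bf bg; rewrite /sint !RintegralD//; try exact: bmf_integrable.
by rewrite opprD addrACA.
Qed.

Lemma sintZ m c g : bmf g -> sint m (fun x => c * g x) = c * sint m g.
Proof.
move=> bg; rewrite /sint !RintegralZl//; try exact: bmf_integrable.
by rewrite mulrBr.
Qed.

Lemma sintB m f g : bmf f -> bmf g ->
  sint m (fun x => f x - g x) = sint m f - sint m g.
Proof.
move=> bf bg; rewrite /sint !RintegralB//; try exact: bmf_integrable.
by ring.
Qed.

Lemma sint_sum m (I : Type) (r : seq I) (f : I -> R -> R) :
  (forall i, bmf (f i)) ->
  sint m (fun x => \sum_(i <- r) f i x) = \sum_(i <- r) sint m (f i).
Proof.
move=> bf; elim: r => [|i r IH].
  under eq_fun do rewrite big_nil.
  by rewrite big_nil /sint !Rintegral_cst// !mul0r subrr.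
under eq_fun do rewrite big_cons.
by rewrite big_cons sintD// ?IH//; exact: bmf_sum.
Qed.

Lemma sint_cst m c : sint m (fun=> c) = c * sint m (fun=> 1).
Proof.
rewrite -sintZ; last exact: bmf_cst.
by congr sint; apply/funext => x; rewrite mulr1.
Qed.

Let le_Rint (mu : fmeas) g M : bmf g -> (forall x, `|g x| <= M) ->
  `|\int[mu]_x g x| <= M * fine (mu setT).
Proof.
move=> bg gM.
apply: (le_trans (le_normr_Rintegral _ _)) => //; first exact: bmf_integrable.
rewrite -Rintegral_cst//; apply: le_Rintegral => //.
- have [mg [N gN]] := bg.
  apply: (@bmf_integrable mu (fun x => `|g x|)); split.
    exact: measurableT_comp.
  by exists N => x; rewrite normr_id.
- by apply: (@bmf_integrable mu (fun=> M)); exact: bmf_cst.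
Qed.

Lemma sint_le m g M : bmf g -> (forall x, `|g x| <= M) ->
  `|sint m g| <= M * smass m.
Proof.
move=> bg gM; rewrite (le_trans (ler_normB _ _))// mulrDr lerD//;
  exact: le_Rint.
Qed.

Let Rint_dct (mu : fmeas) (g_ : nat -> R -> R) g M :
  (forall n, bmf (g_ n)) -> (forall n x, `|g_ n x| <= M) ->
  (forall x, g_ ^~ x @ \oo --> g x) ->
  \int[mu]_x g_ n x @[n --> \oo] --> \int[mu]_x g x.
Proof.
move=> bg gM gg.
have mg : measurable_fun [set: T] (g : T -> R).
  apply: (@measurable_fun_cvg _ _ _ _ g_) => //.
  by move=> n; case: (bg n).
have [//|||||ig _ h] := @dominated_convergence _ T R mu setT measurableT
  (fun n => EFin \o g_ n) (EFin \o g) (cst M%:E).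
- by move=> n; apply/measurable_EFinP; case: (bg n).
- exact/measurable_EFinP.
- by apply: aeW => x _; apply: cvg_EFin; [near=> n|exact: gg].
- exact: (finite_measure_integrable_cst mu M measurableT).
- by apply: aeW => x n _ /=; rewrite lee_fin.
have ff := integrable_fin_num measurableT ig.
apply: fine_cvg; rewrite fineK//.
Unshelve. all: by end_near. Qed.

Lemma sint_dct m (g_ : nat -> R -> R) g M :
  (forall n, bmf (g_ n)) -> (forall n x, `|g_ n x| <= M) ->
  (forall x, g_ ^~ x @ \oo --> g x) ->
  sint m (g_ n) @[n --> \oo] --> sint m g.
Proof.
by move=> bg gM gg; apply: cvgB; apply: Rint_dct gg.
Qed.

End BoundedMeasurable.

(** * Mixtures of test functions *)

Section Fubini.
Context {R : realType}.
Notation T := (measurableTypeR R).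
Notation fmeas := {finite_measure set T -> \bar R}.
Notation leb := (@lebesgue_measure R).
Variables (phi : R -> R) (k : R -> R -> R) (M : R).
Hypothesis iphi : leb.-integrable setT (EFin \o phi).
Hypothesis mk : measurable_fun [set: T * T] (fun z : T * T => k z.1 z.2).
Hypothesis kM : forall t x, `|k t x| <= M.

Definition mixture (x : R) : R := \int[leb]_t (phi t * k t x).

Let mphi : measurable_fun [set: T] (phi : T -> R).
Proof. by apply/measurable_EFinP; exact: measurable_int iphi. Qed.

Let f (z : T * T) : \bar R := (phi z.1 * k z.1 z.2)%:E.

Let mf : measurable_fun [set: T * T] f.
Proof.
apply/measurable_EFinP; apply: measurable_funM => //.
by apply: (measurableT_comp mphi); exact: measurable_fst.
Qed.

Lemma bmf_kernel t : bmf (k t).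
Proof.
split; last by exists M.
exact: (measurableT_comp mk (measurable_pair1 t)).
Qed.

Let mkx x : measurable_fun [set: T] (fun t : T => k t x).
Proof. exact: (measurableT_comp mk (measurable_pair2 x)). Qed.

Let iabs : leb.-integrable setT (EFin \o (fun t => M * `|phi t|)).
Proof.
exact: (integrableZl measurableT M (integrable_norm iphi)).
Qed.

Let iphik x : leb.-integrable setT (EFin \o (fun t => phi t * k t x)).
Proof.
apply: le_integrable iabs => //.
  by apply/measurable_EFinP; apply: measurable_funM => //; exact: mkx.
move=> t _ /=; rewrite lee_fin normrM mulrC.
by rewrite (le_trans _ (ler_norm _))// ler_wpM2r.
Qed.

Section OneMeasure.
Variable mu : fmeas.

Let fint : (leb \x mu)%E.-integrable setT f.
Proof.
apply/integrable12ltyP => //=.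
apply: (@le_lt_trans _ _ (\int[leb]_t (((M * fine (mu setT))%:E * `|(phi t)%:E|)%E)))%E.
  apply: ge0_le_integral => //.
  - move=> t _; exact: integral_ge0.
  - apply: (measurable_fun_fubini_tonelli_F (fun z => `|f z|%E)) => //.
    exact: measurableT_comp.
  - apply: emeasurable_funM => //; apply: measurableT_comp => //.
    exact/measurable_EFinP.
  move=> t _; rewrite (mulrC M) EFinM -muleA.
  rewrite fineK ?fin_num_measure// muleC -[X in (_ <= X * _)%E]/((M * `|phi t|)%:E).
  rewrite -(@integral_cst _ _ _ mu)//; apply: ge0_le_integral => //.
  - apply/measurable_EFinP; apply: measurableT_comp => //.
    by apply: measurable_funM => //; case: (bmf_kernel t).
  - by move=> x _; rewrite /f/= lee_fin normrM mulrC ler_wpM2r.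
rewrite ge0_integralZl//.
- case/integrableP : iphi => _ h; rewrite lte_mul_pinfty//.
  by rewrite lee_fin mulr_ge0 ?fine_ge0// (le_trans _ (kM 0 0)).
- by apply: measurableT_comp => //; exact/measurable_EFinP.
- by rewrite lee_fin mulr_ge0 ?fine_ge0// (le_trans _ (kM 0 0)).
Qed.

Let FE t : (\int[mu]_x f (t, x))%E = (phi t * \int[mu]_x k t x)%:E.
Proof.
have bk := bmf_integrable mu (bmf_kernel t).
rewrite -RintegralZl// /Rintegral fineK//.
apply: integrable_fin_num => //.
by apply: bmf_integrable; apply: bmfZ; exact: bmf_kernel.
Qed.

Let GE x : (\int[leb]_t f (t, x))%E = (mixture x)%:E.
Proof.
rewrite /mixture /Rintegral fineK//.
exact: (integrable_fin_num measurableT (iphik x)).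
Qed.

Lemma measurable_mixed1 :
  measurable_fun [set: T] (fun t : T => phi t * \int[mu]_x k t x).
Proof.
apply/measurable_EFinP.
have := measurable_fubini_F fint.
by apply: eq_measurable_fun => t _; rewrite /fubini_F FE.
Qed.

Lemma measurable_mixture : measurable_fun [set: T] (mixture : T -> R).
Proof.
apply/measurable_EFinP.
have := measurable_fubini_G fint.
by apply: eq_measurable_fun => t _; rewrite /fubini_G GE.
Qed.

Lemma integral_mixture1 :
  \int[leb]_t (phi t * \int[mu]_x k t x) = \int[mu]_x mixture x.
Proof.
rewrite /Rintegral; congr fine.
under eq_integral do rewrite -FE.
under [RHS]eq_integral do rewrite -GE.
exact: (Fubini fint).
Qed.

End OneMeasure.

Lemma bmf_mixture : bmf mixture.
Proof.
split; first exact: (measurable_mixture mzero).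
exists (\int[leb]_t (M * `|phi t|)) => x.
apply: (le_trans (le_normr_Rintegral measurableT (iphik x))).
apply: le_Rintegral => //.
- exact: (integrable_norm (iphik x)).
- by move=> t _; rewrite normrM mulrC ler_wpM2r.
Qed.

Lemma integrable_mixed (m : fmeas * fmeas) :
  leb.-integrable setT (EFin \o (fun t => phi t * sint m (k t))).
Proof.
apply: le_integrable (integrableZl measurableT (smass m) iabs) => //.
  apply/measurable_EFinP.
  rewrite (_ : (fun _ => _) = (fun t => phi t * \int[m.1]_x k t x
     - phi t * \int[m.2]_x k t x)); last first.
    by apply/funext => t; rewrite /sint mulrBr.
  by apply: measurable_funB; exact: measurable_mixed1.
move=> t _ /=; rewrite lee_fin normrM mulrC.
rewrite (le_trans _ (ler_norm _))// mulrA ler_wpM2r// mulrC.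
apply: sint_le => //; exact: bmf_kernel.
Qed.

Lemma sint_mixture (m : fmeas * fmeas) :
  sint m mixture = \int[leb]_t (phi t * sint m (k t)).
Proof.
rewrite {1}/sint -!integral_mixture1 -RintegralB//.
- by apply: eq_Rintegral => t _; rewrite /sint mulrBr.
- have := integrable_mixed (m.1, mzero : fmeas).
  apply: eq_integrable => // t _ /=; congr (_ * _)%:E; rewrite /sint/=.
  by rewrite {2}/Rintegral integral_measure_zero subr0.
- have := integrable_mixed (m.2, mzero : fmeas).
  apply: eq_integrable => // t _ /=; congr (_ * _)%:E; rewrite /sint/=.
  by rewrite {2}/Rintegral integral_measure_zero subr0.
Qed.

(** By Fubini the integral of a mixture is an average of integrals of the
kernel; these are bounded uniformly in [n], so dominated convergence applies to
the average. *)
Lemma cvg_sint_mixture (m_ : nat -> fmeas * fmeas) m C :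
  (forall n, smass (m_ n) <= C) ->
  (forall t, sint (m_ n) (k t) @[n --> \oo] --> sint m (k t)) ->
  sint (m_ n) mixture @[n --> \oo] --> sint m mixture.
Proof.
move=> mC cv; rewrite sint_mixture.
under eq_fun do rewrite sint_mixture.
have C0 : 0 <= C := le_trans (smass_ge0 _) (mC 0).
have [//|||||ig _ h] := @dominated_convergence _ T R leb setT measurableT
  (fun n => EFin \o (fun t => phi t * sint (m_ n) (k t)))
  (EFin \o (fun t => phi t * sint m (k t)))
  (EFin \o (fun t => C * (M * `|phi t|))).
- by move=> n; exact: measurable_int (integrable_mixed (m_ n)).
- exact: measurable_int (integrable_mixed m).
- apply: aeW => t _; apply: cvg_EFin; first by near=> n.
  by apply: cvgM; [exact: cvg_cst|exact: cv].
- exact: (integrableZl measurableT C iabs).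
- apply: aeW => t n _ /=; rewrite lee_fin normrM mulrC mulrA ler_wpM2r//.
  rewrite mulrC (@le_trans _ _ (M * smass (m_ n)))//.
    by apply: sint_le => //; exact: bmf_kernel.
  by rewrite ler_wpM2l// (le_trans _ (kM 0 0)).
have ff := integrable_fin_num measurableT ig.
by apply: fine_cvg; rewrite fineK.
Unshelve. all: by end_near. Qed.

End Fubini.

(** * The Fejer kernel *)

Section Trigo.
Context {R : realType}.
Implicit Types x y z t : R.

Lemma mvt_point (f df : R -> R) x y : (forall z, is_derive z 1 f (df z)) ->
  exists c, `|c - x| <= `|y - x| /\ f y - f x = df c * (y - x).
Proof.
move=> fdf.
have cf : continuous f.
  by move=> z; apply/differentiable_continuous/derivable1_diffP; case: (fdf z).
have [xy|/ltW yx] := leP x y.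
  have [c + E] := MVT_segment xy (fun z _ => fdf z) (continuous_subspaceT cf).
  rewrite in_itv/= => /andP[xc cy]; exists c; split => //.
  by rewrite !ger0_norm ?subr_ge0// lerD2r.
have [c + E] := MVT_segment yx (fun z _ => fdf z) (continuous_subspaceT cf).
rewrite in_itv/= => /andP[yc cx]; exists c; split.
  by rewrite !ler0_norm ?subr_le0// lerN2 lerD2r.
by rewrite -opprB E -mulrN opprB.
Qed.

Lemma sin_lip x y : `|sin y - sin x| <= `|y - x|.
Proof.
have [c [_ ->]] := mvt_point x y (@is_derive_sin R).
by rewrite normrM ler_piMl// cos_max.
Qed.

Lemma cos_lip x y : `|cos y - cos x| <= `|y - x|.
Proof.
have [c [_ ->]] := mvt_point x y (@is_derive_cos R).
by rewrite normrM ler_piMl// normrN sin_max.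
Qed.

Lemma sin_le_id x : `|sin x| <= `|x|.
Proof. by have := sin_lip 0 x; rewrite sin0 !subr0. Qed.

Lemma one_sub_cos x : 1 - cos x = 2 * sin (x / 2) ^+ 2.
Proof.
have {1}-> : x = (x / 2) *+ 2 by rewrite -mulr_natr; field.
by rewrite cos_mulr2n cos2sin2; ring.
Qed.

Lemma one_sub_cos_ge0 x : 0 <= 1 - cos x.
Proof. by rewrite subr_ge0 cos_le1. Qed.

Lemma one_sub_cos_le x : 1 - cos x <= x ^+ 2 / 2.
Proof.
rewrite one_sub_cos -[sin _ ^+ 2]real_normK ?num_real//.
have h : `|sin (x / 2)| ^+ 2 <= (x / 2) ^+ 2.
  by rewrite -[leRHS]real_normK ?num_real// lerXn2r// sin_le_id.
have -> : x ^+ 2 / 2 = 2 * (x / 2) ^+ 2 by field.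
by rewrite ler_pM2l.
Qed.

Lemma sub_sin x : exists c, `|c| <= `|x| /\ x - sin x = (1 - cos c) * x.
Proof.
have hd z : is_derive z 1 (fun x => x - sin x) (1 - cos z).
  by apply: is_deriveB.
have [c [cx E]] := mvt_point 0 x hd.
by exists c; move: cx E; rewrite sin0 !subr0 => cx ->.
Qed.

Lemma sub_sin_le3 x : `|x - sin x| <= `|x| ^+ 3 / 2.
Proof.
have [c [cx ->]] := sub_sin x.
rewrite normrM (ger0_norm (one_sub_cos_ge0 _)) exprSr mulrAC ler_wpM2r//.
rewrite (le_trans (one_sub_cos_le c))// ler_pM2r// -real_normK ?num_real//.
by rewrite lerXn2r.
Qed.

Lemma sub_sin_le x : `|x - sin x| <= x ^+ 2.
Proof.
have [c [cx E]] := sub_sin x.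
have h := sub_sin_le3 x.
have : `|x - sin x| <= 2 * `|x|.
  rewrite E normrM ler_wpM2r// ger0_norm ?one_sub_cos_ge0//.
  by have := cos_geN1 c; lra.
(* the cubic bound is the better one when |x| <= 2, the linear one otherwise *)
rewrite -[x ^+ 2]real_normK ?num_real//; move: (normr_ge0 x) h.
by move: `|x - _| `|x| => a b; rewrite exprS; nra.
Qed.

Lemma one_sub_cos_taylor x : `|x ^+ 2 / 2 - (1 - cos x)| <= x ^+ 4 / 8.
Proof.
rewrite one_sub_cos; set z := x / 2.
have -> : x = 2 * z by rewrite /z; field.
(* a difference of squares, by the half-angle formula *)
rewrite (_ : _ - _ = 2 * ((z - sin z) * (z + sin z))); last by field.
have h1 := sub_sin_le3 z.
have h2 : `|z + sin z| <= 2 * `|z|.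
  by rewrite (le_trans (ler_normD _ _))//; have := sin_le_id z; lra.
rewrite normrM ger0_norm// normrM.
have -> : (2 * z) ^+ 4 / 8 = 2 * (`|z| ^+ 3 / 2 * (2 * `|z|)).
  have -> : `|z| ^+ 3 / 2 * (2 * `|z|) = (`|z| ^+ 2) ^+ 2 by field.
  by rewrite real_normK ?num_real//; field.
by rewrite ler_pM2l// ler_pM.
Qed.

(** The Fejer kernel before normalisation, extended by continuity. *)
Definition wker (y : R) : R := if y == 0 then 2^-1 else (1 - cos y) / y ^+ 2.

Lemma wkerE y : y ^+ 2 * wker y = 1 - cos y.
Proof.
rewrite /wker; case: eqVneq => [->|y0]; first by rewrite expr0n mul0r cos0 subrr.
by rewrite mulrC divfK// sqrf_eq0.
Qed.

Lemma wkerN y : wker (- y) = wker y.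
Proof. by rewrite /wker oppr_eq0 cosN sqrrN. Qed.

Lemma wker_ge0 y : 0 <= wker y.
Proof.
by rewrite /wker; case: ifP => _; rewrite ?divr_ge0 ?one_sub_cos_ge0 ?sqr_ge0.
Qed.

Lemma wker_dist y : `|2^-1 - wker y| <= y ^+ 2 / 8.
Proof.
rewrite /wker; case: eqVneq => [->|y0].
  by rewrite subrr normr0 expr0n mul0r.
have y2 : 0 < y ^+ 2 by rewrite exprn_even_gt0.
rewrite -(ler_pM2l y2) -{1}(ger0_norm (ltW y2)) -normrM.
rewrite mulrBr mulrCA divff ?gt_eqF// mulr1 mulrA -exprD.
exact: one_sub_cos_taylor.
Qed.

Lemma wker_le y : wker y <= 2^-1.
Proof.
rewrite /wker; case: eqVneq => // y0.
have y2 : 0 < y ^+ 2 by rewrite exprn_even_gt0.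
by rewrite ler_pdivrMr// mulrC; exact: one_sub_cos_le.
Qed.

Lemma wker_ge y : `|y| <= 1 -> 3 / 8 <= wker y.
Proof.
move=> y1; have := wker_dist y; rewrite ler_norml => /andP[_].
have : y ^+ 2 <= 1 by rewrite -real_normK ?num_real// expr_le1.
lra.
Qed.

Lemma wker_decay y : wker y <= (5 / 2) / (1 + y ^+ 2).
Proof.
have h : 0 < 1 + y ^+ 2 by rewrite ltr_pwDl// sqr_ge0.
rewrite ler_pdivlMr// mulrDr mulr1 [_ * y ^+ 2]mulrC wkerE.
have := wker_le y; have := cos_geN1 y; lra.
Qed.

Lemma continuous_wker : continuous wker.
Proof.
move=> y; have [->|y0] := eqVneq y 0.
  rewrite /continuous_at {2}/wker eqxx.
  have h : 2^-1 - x ^+ 2 / 8 @[x --> (0:R)] --> (2^-1 : R).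
    rewrite -[X in _ --> X]subr0 -[X in _ - X](mul0r (8^-1)).
    rewrite -[X in X * _ ](_ : 0 ^+ 2 = 0); last by rewrite expr0n.
    apply: cvgB; first exact: cvg_cst.
    by apply: cvgMl; exact: exprn_continuous.
  have h' : 2^-1 @[x --> (0:R)] --> (2^-1 : R) by exact: cvg_cst.
  apply: (squeeze_cvgr _ h h'); near=> x; rewrite wker_le andbT.
  by have := wker_dist x; rewrite ler_norml => /andP[_]; lra.
have: {for y, continuous (fun y => (1 - cos y) / y ^+ 2)}.
  apply: cvgM.
    by apply: cvgB; [exact: cvg_cst|exact: continuous_cos].
  by apply: cvgV; [rewrite sqrf_eq0|exact: exprn_continuous].
rewrite /prop_for /continuous_at {2}/wker (negbTE y0).
apply: cvg_trans; apply: near_eq_cvg.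
near=> x; rewrite /wker ifF//; apply/negbTE.
near: x; apply: (@cvgr_neq0 _ _ _ _ _ id y) => //; exact: cvg_id.
Unshelve. all: by end_near. Qed.

Notation leb := (@lebesgue_measure R).

Let w_scaled (a : R) : 0 < a ->
  (\int[leb]_t (wker t)%:E = \int[leb]_t (a * wker (a * t))%:E)%E.
Proof.
move=> a0; have da t : is_derive t 1 ( *%R a) a.
  by rewrite -[X in is_derive _ _ _ X]mulr1; exact: is_deriveZ.
have d1 : derive1 ( *%R a) = cst a.
  by apply/funext => t; rewrite derive1E; have [_ ->] := da t.
rewrite (@increasing_ge0_integration_by_substitutionT _ ( *%R a) wker).
- by rewrite d1; apply: eq_integral => t _; rewrite mulrC.
- by move=> x y xy; rewrite ltr_pM2l.
- by rewrite d1; exact: cst_continuous.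
- by rewrite d1; apply: is_cvg_cst.
- by rewrite d1; apply: is_cvg_cst.
- by move=> x; case: (da x).
- exact: gt0_cvgMrNy.
- exact: gt0_cvgMry.
- exact: continuous_wker.
- exact: wker_ge0.
Qed.

Lemma integrable_wker : leb.-integrable setT (EFin \o wker).
Proof.
apply/integrableP; split.
  by apply/measurable_EFinP; exact: (continuous_measurable_fun continuous_wker).
have cg : continuous (fun y : R => (5 / 2) * (oneDsqr y)^-1).
  move=> y; apply: cvgM; first exact: cvg_cst.
  exact: continuous_oneDsqrV.
apply: (@le_lt_trans _ _ (\int[leb]_y ((5 / 2) * (oneDsqr y)^-1)%:E)%E).
  apply: ge0_le_integral => //.
  - apply: measurableT_comp => //; apply/measurable_EFinP.
    exact: (continuous_measurable_fun continuous_wker).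
  - by apply/measurable_EFinP; exact: (continuous_measurable_fun cg).
  - move=> y _ /=; rewrite lee_fin ger0_norm ?wker_ge0//; exact: wker_decay.
have q0 (y : R) : 0 <= (oneDsqr y)^-1.
  by rewrite invr_ge0 (le_trans ler01)// oneDsqr_ge1.
rewrite ge0_symfun_integralT//.
- rewrite -set_itvcy; under eq_integral do rewrite EFinM.
  rewrite ge0_integralZl//.
  + by rewrite integral0y_oneDsqr -!EFinM ltry.
  + apply/measurable_EFinP/measurable_funTS.
    exact: (continuous_measurable_fun (@continuous_oneDsqrV R)).
- by move=> y /=; rewrite /oneDsqr sqrrN.
Qed.

Definition wmass : R := \int[leb]_t wker t.

Lemma wmass_gt0 : 0 < wmass.
Proof.
rewrite lt_neqAle; apply/andP; split; last first.
  by apply: Rintegral_ge0 => t _; exact: wker_ge0.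
have : 3 / 8 <= wmass; last by move: wmass => c h; rewrite lt_eqF//; lra.
have m01 : leb `[0, 1]%classic = 1%E.
  by rewrite lebesgue_measure_itv/= lte01 sube0.
have i01 : leb.-integrable setT (EFin \o \1_(`[0, 1]%classic : set R)).
  apply/integrableP; split; first exact/measurable_EFinP/measurable_indic.
  under eq_integral do rewrite /= ger0_norm//.
  by rewrite integral_indic//= setIT m01 ltry.
have -> : 3 / 8 = \int[leb]_t (3 / 8 * \1_(`[0, 1]) t).
  rewrite RintegralZl//.
  by rewrite /Rintegral integral_indic//= setIT m01 mulr1.
apply: le_Rintegral => //.
- exact: (integrableZl measurableT (3 / 8) i01).
- exact: integrable_wker.
- move=> t _; rewrite indicE; have [|_] := boolP (_ \in _); last first.
    by rewrite mulr0 wker_ge0.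
  rewrite inE/= in_itv/= => /andP[t0 t1]; rewrite mulr1 wker_ge//.
  by rewrite ger0_norm.
Qed.

Let wpos (a : R) : 0 < a ->
  leb.-integrable setT (EFin \o (fun t => a ^+ 2 * wker (a * t))) /\
  \int[leb]_t (a ^+ 2 * wker (a * t)) = a * wmass.
Proof.
move=> a0.
have ca : continuous (fun t => a * wker (a * t)).
  move=> t; apply: cvgM; first exact: cvg_cst.
  apply: (@continuous_comp _ _ _ ( *%R a) wker); last exact: continuous_wker.
  by apply: cvgM; [exact: cvg_cst|exact: cvg_id].
have ia : leb.-integrable setT (EFin \o (fun t => a * wker (a * t))).
  apply/integrableP; split.
    by apply/measurable_EFinP; exact: (continuous_measurable_fun ca).
  under eq_integral do rewrite /= ger0_norm ?mulr_ge0 ?wker_ge0 ?(ltW a0)//.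
  rewrite -w_scaled//; have /integrableP[_] := integrable_wker.
  by under eq_integral do rewrite /= ger0_norm ?wker_ge0//.
have E : (fun t => a ^+ 2 * wker (a * t)) = (fun t => a * (a * wker (a * t))).
  by apply/funext => t; rewrite mulrA expr2.
rewrite E; split; first exact: (integrableZl measurableT a ia).
by rewrite RintegralZl// {1}/Rintegral -w_scaled.
Qed.

(** The change of variables [t -> a t], and evenness of the kernel for negative
[a]. *)
Lemma wker_scale (a : R) :
  leb.-integrable setT (EFin \o (fun t => a ^+ 2 * wker (a * t))) /\
  \int[leb]_t (a ^+ 2 * wker (a * t)) = `|a| * wmass.
Proof.
have [a0|a0|->] := ltgtP a 0; last 2 first.
- by rewrite gtr0_norm//; exact: wpos.
- rewrite (_ : (fun _ => _) = cst 0); last first.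
    by apply/funext => t; rewrite expr0n/= mul0r.
  by split; [exact: integrable0|rewrite Rintegral_cst// normr0 !mul0r].
have := wpos (_ : 0 < - a); rewrite oppr_gt0 => /(_ a0).
rewrite ltr0_norm// sqrrN (_ : (fun _ => _) = (fun t => a ^+ 2 * wker (a * t)))//.
by apply/funext => t; rewrite mulNr wkerN.
Qed.

Definition fejer (d t : R) : R := 2 * (d ^+ 2 * wker (d * t)).

(** The tent of height [2 d] supported in [-d, d], as a second difference of the
absolute value. *)
Definition hat (d y : R) : R := `|y + d| + `|y - d| - 2 * `|y|.

Lemma integrable_fejer d : leb.-integrable setT (EFin \o fejer d).
Proof. exact: (integrableZl measurableT 2 (wker_scale d).1). Qed.

Let fejer_cosE d t y : fejer d t * cos (t * y) =
  (y + d) ^+ 2 * wker ((y + d) * t) + (y - d) ^+ 2 * wker ((y - d) * t)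
  - 2 * (y ^+ 2 * wker (y * t)).
Proof.
rewrite /fejer; have [->|t0] := eqVneq t 0.
  by rewrite !mulr0 mul0r cos0 /wker eqxx; field.
have t2 : t ^+ 2 != 0 by rewrite sqrf_eq0.
have E (a : R) : a ^+ 2 * wker (a * t) = (1 - cos (a * t)) / t ^+ 2.
  by rewrite -wkerE exprMn; field.
rewrite !E [(y + d) * t]mulrDl [(y - d) * t]mulrBl cosD cosB [t * y]mulrC; field; exact: t0.
Qed.

(** The identity behind the Fourier transform of the Fejer kernel:
[(2 - 2 cos (d t)) cos (t y)] is a second difference in [y] of
[1 - cos (t y)], and [(1 - cos (a t)) / t ^ 2] integrates to a multiple of
[|a|] by scaling. *)
Lemma fejer_cos d y : \int[leb]_t (fejer d t * cos (t * y)) = wmass * hat d y.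
Proof.
under eq_Rintegral do rewrite fejer_cosE.
have [i1 e1] := wker_scale (y + d).
have [i2 e2] := wker_scale (y - d).
have [i3 e3] := wker_scale y.
have i3' := integrableZl measurableT 2 i3.
rewrite RintegralB//; last exact: (integrableD measurableT i1 i2).
rewrite RintegralD// [X in _ - X]RintegralZl//.
transitivity (`|y + d| * wmass + `|y - d| * wmass - 2 * (`|y| * wmass)).
  by congr (_ + _ - _ * _).
by rewrite /hat; ring.
Qed.

End Trigo.

(** * Fourier transforms determine integrals of compactly supported functions *)

Section UniformContinuity.
Context {R : realType}.
Implicit Types (g : R -> R) (N e : R).

Lemma segment_unif_continuous g a b e : continuous g -> 0 < e ->
  exists2 d : R, 0 < d & forall x y, a <= x <= b -> `|x - y| <= d ->
    `|g x - g y| <= e.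
Proof.
move=> cg e0.
have /compact_near_coveringP cov := @segment_compact R a b.
have : \forall d \near (0:R)^'+, `[a, b] `<=` [set x | forall y,
    `|x - y| <= d -> `|g x - g y| <= e].
  apply: cov => x _.
  have e2 : 0 < e / 2 by rewrite divr_gt0.
  have /cvgrPdist_le /(_ _ e2) /nbhs_ballP [r /= r0 rP] := cg x.
  have r2 : 0 < r / 2 by rewrite divr_gt0.
  exists (ball x (r / 2), [set d | d < r / 2]) => /=.
    by split; [exact: nbhsx_ballx|exact: nbhs_right_lt].
  move=> [x' d] /= [xx' dr] y x'y.
  rewrite /ball/= in xx'.
  have h1 : `|g x - g x'| <= e / 2.
    by apply: rP; rewrite /ball/= (lt_trans xx')// ltr_pdivrMr// ltr_pMr// ltr1n.
  have h2 : `|g x - g y| <= e / 2.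
    apply: rP; rewrite /ball/= (_ : x - y = (x - x') + (x' - y)); last by ring.
    rewrite (le_lt_trans (ler_normD _ _))//.
    by rewrite [ltRHS]splitr ltrD// (le_lt_trans x'y).
  rewrite (_ : g x' - g y = (g x - g y) - (g x - g x')); last by ring.
  by rewrite (le_trans (ler_normB _ _))// [leRHS]splitr lerD.
move=> h.
have [d [d0 dP]] : exists d, 0 < d /\ `[a, b] `<=` [set x | forall y,
    `|x - y| <= d -> `|g x - g y| <= e].
  near ((0:R)^'+) => d; exists d; split; first by near: d; exact: nbhs_right_gt.
  by near: d.
by exists d => // x y xab xy; apply: (dP x) => //; rewrite /= in_itv.
Unshelve. all: by end_near. Qed.

Definition compactly_supported (N : R) (g : R -> R) : Prop :=
  continuous g /\ forall x, N < `|x| -> g x = 0.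

Lemma compactly_supported_unif N g e : compactly_supported N g -> 0 < e ->
  exists2 d : R, 0 < d & forall x y, `|x - y| <= d -> `|g x - g y| <= e.
Proof.
move=> [cg g0] e0.
have [d d0 dP] := segment_unif_continuous (- N) N cg e0.
exists d => // x y xy.
have [xN|xN] := leP `|x| N; first by apply: dP => //; rewrite -ler_norml.
have [yN|yN] := leP `|y| N.
  by rewrite distrC; apply: dP; rewrite -?ler_norml// distrC.
by rewrite !g0// subrr normr0 ltW.
Qed.

Lemma compactly_supported_bounded N g : compactly_supported N g ->
  exists M, forall x, `|g x| <= M.
Proof.
move=> [cg g0]; have [N0|N0] := leP 0 N; last first.
  by exists 0 => x; rewrite g0 ?normr0// (lt_le_trans N0).
have NN : - N <= N by lra.
have [c _ cM] := EVT_max NN (continuous_subspaceT (fun x => cvg_norm (cg x))).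
exists `|g c| => x; have [xN|xN] := leP `|x| N.
  by apply: cM; rewrite in_itv/= -ler_norml.
by rewrite (g0 x)// normr0.
Qed.

Lemma compactly_supported_bmf N g : compactly_supported N g -> bmf g.
Proof.
move=> cg; have [M gM] := compactly_supported_bounded cg.
exact: (bmf_continuous cg.1 gM).
Qed.

End UniformContinuity.

Section Approximation.
Context {R : realType}.
Notation T := (measurableTypeR R).
Notation fmeas := {finite_measure set T -> \bar R}.
Implicit Types (g f v : R -> R).

(** The error at [x] is an average of the increments [g x - g (p j)] over the
pieces that contain [x]; where the weights do not sum to one, [g] vanishes. *)
Lemma partition_of_unity_approx (m : nat) (w : nat -> R -> R) (p : nat -> R)
    g d e : 0 <= e ->
  (forall j x, 0 <= w j x) -> (forall x, \sum_(j < m) w j x <= 1) ->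
  (forall x, g x != 0 -> \sum_(j < m) w j x = 1) ->
  (forall j x, w j x != 0 -> `|x - p j| <= d) ->
  (forall x y, `|x - y| <= d -> `|g x - g y| <= e) ->
  forall x, `|g x - \sum_(j < m) g (p j) * w j x| <= e.
Proof.
move=> e0 w0 w1 wg wd gd x.
have -> : g x - \sum_(j < m) g (p j) * w j x =
    \sum_(j < m) (g x - g (p j)) * w j x.
  under [RHS]eq_bigr do rewrite mulrBl.
  rewrite sumrB -mulr_sumr; congr (_ - _).
  have [->|gx] := eqVneq (g x) 0; first by rewrite mul0r.
  by rewrite wg// mulr1.
rewrite (le_trans (ler_norm_sum _ _ _))//.
rewrite (@le_trans _ _ (\sum_(j < m) e * w j x))//; last first.
  by rewrite -mulr_sumr ler_piMr.
apply: ler_sum => j _; rewrite normrM (ger0_norm (w0 _ _)).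
have [->|wj] := eqVneq (w j x) 0; first by rewrite !mulr0.
by rewrite ler_wpM2r// gd// wd.
Qed.

(** Replacing the test function costs at most the uniform error times the bound
on the masses, for all [n] at once. *)
Lemma cvg_sint_approx (m_ : nat -> fmeas * fmeas) m C f :
  (forall n, smass (m_ n) <= C) -> bmf f ->
  (forall e, 0 < e -> exists h, [/\ bmf h, forall x, `|f x - h x| <= e &
    sint (m_ n) h @[n --> \oo] --> sint m h]) ->
  sint (m_ n) f @[n --> \oo] --> sint m f.
Proof.
move=> mC bf fh.
have C0 : 0 <= C := le_trans (smass_ge0 _) (mC 0).
apply/cvgrPdist_le => e e0.
pose D := C + smass m + 1.
have D0 : 0 < D by rewrite ltr_wpDl// addr_ge0// smass_ge0.
have eD : 0 < e / (2 * D) by rewrite divr_gt0// mulr_gt0.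
have [h [bh fhe ch]] := fh _ eD.
have e2 : 0 < e / 2 by rewrite divr_gt0.
move/cvgrPdist_le : ch => /(_ _ e2); apply: filterS => n hn.
have h1 k : `|sint k f - sint k h| <= e / (2 * D) * smass k.
  by rewrite -sintB//; apply: sint_le => //; exact: bmfB.
rewrite (_ : _ - _ = (sint m f - sint m h) + (sint m h - sint (m_ n) h)
  - (sint (m_ n) f - sint (m_ n) h)); last by ring.
rewrite (le_trans (ler_normB _ _))//.
have h4 := ler_normD (sint m f - sint m h) (sint m h - sint (m_ n) h).
have h2 := h1 m; have h3 := h1 (m_ n).
have h5 : e / (2 * D) * smass m + e / (2 * D) * smass (m_ n) <= e / 2.
  rewrite -mulrDr (@le_trans _ _ (e / (2 * D) * D))//.
    by rewrite ler_wpM2l// ?(ltW eD)// /D; have := mC n; lra.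
  by rewrite le_eqVlt; apply/orP; left; apply/eqP; field; rewrite gt_eqF.
lra.
Qed.

Lemma hat_ge0 (d y : R) : 0 <= hat d y.
Proof.
rewrite /hat; have := ler_normD (y + d) (y - d).
have -> : y + d + (y - d) = 2 * y by ring.
by rewrite normrM (ger0_norm (_ : 0 <= 2))//; lra.
Qed.

Lemma hat_supp (d y : R) : 0 <= d -> d <= `|y| -> hat d y = 0.
Proof.
rewrite /hat => d0; have [y0|y0] := leP 0 y.
- by rewrite ger0_norm// => dy; rewrite !ger0_norm//; lra.
- by rewrite ltr0_norm// => dy; rewrite !ler0_norm//; lra.
Qed.

(** As second differences, translates of the tent along a grid of step [d]
telescope; divided by [2 d] they form a partition of unity on the grid. *)
Lemma hat_sum (d y : R) (m : nat) :
  \sum_(j < m.+1) hat d (y - j%:R * d) =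
  `|y + d| - `|y| + `|y - m.+1%:R * d| - `|y - m%:R * d|.
Proof.
elim: m => [|m IH].
  rewrite big_ord_recl big_ord0 /hat !mul0r mul1r subr0; ring.
rewrite big_ord_recr IH /= /hat.
rewrite (_ : y - m.+1%:R * d + d = y - m%:R * d); last by rewrite -[m.+1%:R]natr1; ring.
rewrite (_ : y - m.+1%:R * d - d = y - m.+2%:R * d); last by rewrite -[m.+2%:R]natr1; ring.
ring.
Qed.

Lemma hat_sum_le (d y : R) (m : nat) : 0 <= d ->
  \sum_(j < m.+1) hat d (y - j%:R * d) <= 2 * d.
Proof.
move=> d0; rewrite hat_sum.
have h1 := ler_normD y d; rewrite (ger0_norm d0) in h1.
have h2 := ler_normB (y - m%:R * d) d; rewrite (ger0_norm d0) in h2.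
move: h2; rewrite (_ : y - m%:R * d - d = y - m.+1%:R * d); first lra.
by rewrite -natr1; ring.
Qed.

Lemma hat_sum_eq (d y : R) (m : nat) : 0 <= d -> 0 <= y <= m%:R * d ->
  \sum_(j < m.+1) hat d (y - j%:R * d) = 2 * d.
Proof.
move=> d0 /andP[y0 ym]; rewrite hat_sum.
have -> : m.+1%:R * d = m%:R * d + d by rewrite -natr1; ring.
rewrite (ger0_norm y0) (ger0_norm (_ : 0 <= y + d)) ?addr_ge0//.
rewrite (ler0_norm (_ : y - (m%:R * d + d) <= 0)); last by lra.
rewrite (ler0_norm (_ : y - m%:R * d <= 0)); last by lra.
ring.
Qed.

Lemma continuous_hat (d : R) : continuous (hat d).
Proof.
move=> y; rewrite /hat; apply: cvgB; first apply: cvgD.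
- by apply: cvg_norm; apply: cvgD; [exact: cvg_id|exact: cvg_cst].
- by apply: cvg_norm; apply: cvgB; [exact: cvg_id|exact: cvg_cst].
- by apply: cvgM; [exact: cvg_cst|apply: cvg_norm; exact: cvg_id].
Qed.

Lemma bmf_hat (d a : R) : 0 <= d -> bmf (fun x => hat d (x - a)).
Proof.
move=> d0; apply: (@bmf_continuous _ _ (2 * d)).
  move=> x; apply: (@continuous_comp _ _ _ (fun x => x - a) (hat d)).
    by apply: cvgB; [exact: cvg_id|exact: cvg_cst].
  exact: continuous_hat.
move=> x; rewrite ger0_norm ?hat_ge0//.
have := @hat_sum_le d (x - a) 0 d0.
by rewrite big_ord_recl big_ord0 mul0r subr0 addr0.
Qed.

Lemma measurable_cos_kernel a v : bmf v ->
  measurable_fun [set: T * T]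
    (fun z : T * T => cos (z.1 * (z.2 - a)) * v z.2).
Proof.
move=> [mv _].
have m1 : measurable_fun [set: T * T] (fun z : T * T => (z.1 : R)).
  exact: measurable_fst.
have m2 : measurable_fun [set: T * T] (fun z : T * T => (z.2 : R)).
  exact: measurable_snd.
apply: measurable_funM; last exact: (measurableT_comp mv m2).
have mcos := continuous_measurable_fun (@continuous_cos R).
apply: (measurableT_comp mcos); apply: measurable_funM => //.
exact: measurable_funB.
Qed.

Lemma bmf_cos t : bmf (fun x : R => cos (t * x)).
Proof.
apply: (@bmf_continuous _ _ 1) => x; last exact: cos_max.
apply: (@continuous_comp _ _ _ ( *%R t) cos); last exact: continuous_cos.
by apply: cvgM; [exact: cvg_cst|exact: cvg_id].
Qed.

Lemma bmf_sin t : bmf (fun x : R => sin (t * x)).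
Proof.
apply: (@bmf_continuous _ _ 1) => x; last exact: sin_max.
apply: (@continuous_comp _ _ _ ( *%R t) sin); last exact: continuous_sin.
by apply: cvgM; [exact: cvg_cst|exact: cvg_id].
Qed.

Lemma cvg_sumr (I : Type) (r : seq I) (u : I -> nat -> R) (l : I -> R) :
  (forall i, u i n @[n --> \oo] --> l i) ->
  \sum_(i <- r) u i n @[n --> \oo] --> \sum_(i <- r) l i.
Proof.
move=> ul; elim: r => [|i r IH].
  under eq_fun do rewrite big_nil.
  by rewrite big_nil; exact: cvg_cst.
under eq_fun do rewrite big_cons.
by rewrite big_cons; exact: cvgD.
Qed.

Lemma cvg_scale_inv (c : R) (u : nat -> R) (l : R) : c != 0 ->
  c * u n @[n --> \oo] --> c * l -> u n @[n --> \oo] --> l.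
Proof.
move=> c0 h; rewrite -[l](mulKf c0) (_ : u = fun n => c^-1 * (c * u n)).
  by apply: cvgM h; exact: cvg_cst.
by apply/funext => n; rewrite mulKf.
Qed.

(** By the Fejer identity a tent is a mixture of cosines, and mixtures preserve
convergence. *)
Lemma cvg_sint_hat (m_ : nat -> fmeas * fmeas) m C v d a :
  (forall n, smass (m_ n) <= C) -> bmf v -> 0 <= d ->
  (forall t, sint (m_ n) (fun x => cos (t * x) * v x) @[n --> \oo]
     --> sint m (fun x => cos (t * x) * v x)) ->
  (forall t, sint (m_ n) (fun x => sin (t * x) * v x) @[n --> \oo]
     --> sint m (fun x => sin (t * x) * v x)) ->
  sint (m_ n) (fun x => hat d (x - a) * v x) @[n --> \oo]
     --> sint m (fun x => hat d (x - a) * v x).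
Proof.
move=> mC bv d0 hc hs.
pose k (t x : R) : R := cos (t * (x - a)) * v x.
have kE t : k t = (fun x => cos (t * a) * (cos (t * x) * v x)
    + sin (t * a) * (sin (t * x) * v x)).
  by apply/funext => x; rewrite /k mulrBr cosB; ring.
have b1 t : bmf (fun x => cos (t * x) * v x) by apply: bmfM => //; exact: bmf_cos.
have b2 t : bmf (fun x => sin (t * x) * v x) by apply: bmfM => //; exact: bmf_sin.
have sk t mm : sint mm (k t) = cos (t * a) * sint mm (fun x => cos (t * x) * v x)
    + sin (t * a) * sint mm (fun x => sin (t * x) * v x).
  by rewrite kE sintD ?sintZ//; exact: bmfZ.
have [mv [M vM]] : bmf v := bv.
have kM t x : `|k t x| <= M.
  by rewrite normrM -[leRHS]mul1r ler_pM// cos_max.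
have mixE : mixture (fejer d) k = (fun x => wmass * (hat d (x - a) * v x)).
  apply/funext => x; rewrite /mixture /k.
  under eq_Rintegral do rewrite mulrA.
  rewrite RintegralZr//; first by rewrite fejer_cos mulrA.
  apply: (le_integrable measurableT _ _ (integrable_fejer d)).
    apply/measurable_EFinP; apply: measurable_funM.
      by apply/measurable_EFinP; exact: measurable_int (integrable_fejer d).
    have [mc _] := bmf_cos (x - a); move: mc.
    by apply: eq_measurable_fun => t _; rewrite mulrC.
  by move=> t _ /=; rewrite lee_fin normrM ler_piMr// cos_max.
have bh : bmf (fun x => hat d (x - a) * v x).
  by apply: bmfM => //; exact: bmf_hat.
have := cvg_sint_mixture (integrable_fejer d) (measurable_cos_kernel a bv) kM
  (m := m) mC.
rewrite mixE sintZ//; under eq_fun do rewrite sintZ//.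
move=> H; have w0 : wmass != 0 :> R by rewrite gt_eqF// wmass_gt0.
apply: (cvg_scale_inv w0); apply: H => t; rewrite sk; under eq_fun do rewrite sk.
by apply: cvgD; (apply: cvgM; first exact: cvg_cst).
Qed.

(** Levy continuity for the signed measures [v dm]: a test function is
approximated by combinations of tents.  Bounded mass does not give tightness
when there are cancellations, hence the compact support. *)
Lemma cvg_sint_compact (m_ : nat -> fmeas * fmeas) m C v g N :
  (forall n, smass (m_ n) <= C) -> bmf v -> compactly_supported N g ->
  (forall t, sint (m_ n) (fun x => cos (t * x) * v x) @[n --> \oo]
     --> sint m (fun x => cos (t * x) * v x)) ->
  (forall t, sint (m_ n) (fun x => sin (t * x) * v x) @[n --> \oo]
     --> sint m (fun x => sin (t * x) * v x)) ->
  sint (m_ n) (fun x => g x * v x) @[n --> \oo]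
     --> sint m (fun x => g x * v x).
Proof.
move=> mC bv cg hc hs.
have bg := compactly_supported_bmf cg.
apply: (cvg_sint_approx mC); first exact: bmfM.
move=> e e0; have [_ [M vM]] := bv.
have M0 : 0 <= M := le_trans (normr_ge0 _) (vM 0).
have e' : 0 < e / (M + 1) by rewrite divr_gt0// ltr_wpDl.
have [d d0 dP] := compactly_supported_unif cg e'.
pose m0 := Num.truncn (2 * N / d).
pose p (j : nat) : R := - N + j%:R * d.
pose w (j : nat) (x : R) : R := (2 * d)^-1 * hat d (x - p j).
have dd : 0 < 2 * d by rewrite mulr_gt0.
have pE j x : x - p j = x + N - j%:R * d by rewrite /p; ring.
have bw j : bmf (w j) by apply: bmfZ; apply: bmf_hat; exact: ltW.
have bwv j : bmf (fun x => w j x * v x) by exact: bmfM.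
have bgw j : bmf (fun x => g (p j) * (w j x * v x)) by exact: bmfZ.
have app : forall x, `|g x - \sum_(j < m0.+2) g (p j) * w j x| <= e / (M + 1).
  apply: (@partition_of_unity_approx _ w p g d) => //; first exact: ltW.
  - by move=> j x; rewrite /w mulr_ge0 ?hat_ge0// invr_ge0 ltW.
  - move=> x; rewrite -mulr_sumr; under eq_bigr do rewrite pE.
    rewrite mulrC ler_pdivrMr// mul1r; exact/hat_sum_le/ltW.
  - move=> x gx; rewrite -mulr_sumr; under eq_bigr do rewrite pE.
    rewrite hat_sum_eq ?mulVf ?gt_eqF//; first exact: ltW.
    have xN : `|x| <= N.
      by rewrite leNgt; apply: contra gx => Nx; rewrite cg.2.
    move: xN; rewrite ler_norml => /andP[xl xr].
    rewrite (_ : 0 <= x + N); last by lra.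
    rewrite -ler_pdivrMr// (@le_trans _ _ (2 * N / d))//.
      by rewrite ler_pM2r ?invr_gt0//; lra.
    by rewrite ltW// truncnS_gt.
  - move=> j x; rewrite leNgt; apply: contra => /ltW h.
    by rewrite /w hat_supp ?mulr0// ltW.
exists (fun x => \sum_(j < m0.+2) g (p j) * (w j x * v x)); split.
- exact: bmf_sum.
- move=> x; under eq_bigr do rewrite mulrA.
  rewrite -mulr_suml -mulrBl normrM (@le_trans _ _ (e / (M + 1) * M))//.
    by rewrite ler_pM.
  by rewrite mulrAC ler_pdivrMr ?ltr_wpDl// ler_pM2l// lerDl.
- rewrite sint_sum//; under eq_fun do rewrite sint_sum//.
  apply: cvg_sumr => j; rewrite sintZ//; under eq_fun do rewrite sintZ//.
  apply: cvgM; first exact: cvg_cst.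
  have bh : bmf (fun x => hat d (x - p j) * v x).
    by apply: bmfM => //; apply: bmf_hat; exact: ltW.
  have E : (fun x => w j x * v x) = (fun x => (2 * d)^-1 * (hat d (x - p j) * v x)).
    by apply/funext => x; rewrite /w mulrA.
  rewrite E sintZ//; under eq_fun do rewrite sintZ//.
  apply: cvgM; first exact: cvg_cst.
  exact: (@cvg_sint_hat m_ m C v d (p j) mC bv (ltW d0) hc hs).
Qed.

End Approximation.

(** * Vague convergence and weighted Fourier transforms *)

Section VagueConvergence.
Context {R : realType}.
Notation T := (measurableTypeR R).
Notation fmeas := {finite_measure set T -> \bar R}.
Implicit Types (g f v : R -> R) (N h t x : R).

Definition vague_convergence (m_ : nat -> fmeas * fmeas) m : Prop :=
  forall N g, compactly_supported N g ->
    sint (m_ n) g @[n --> \oo] --> sint m g.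

Definition clamp (y : R) : R := (`|y| - `|y - 1| + 1) / 2.

Lemma clamp_le0 y : y <= 0 -> clamp y = 0.
Proof.
by move=> y0; rewrite /clamp !ler0_norm//; [field|lra].
Qed.

Lemma clamp_ge1 y : 1 <= y -> clamp y = 1.
Proof.
move=> y1; rewrite /clamp (ger0_norm (_ : 0 <= y)); last by lra.
by rewrite ger0_norm; [field|lra].
Qed.

Lemma clamp_id y : 0 <= y -> y <= 1 -> clamp y = y.
Proof.
move=> y0 y1; rewrite /clamp (ger0_norm y0) ler0_norm; last by lra.
by field.
Qed.

Lemma clamp_itv y : 0 <= clamp y <= 1.
Proof.
have [y0|/ltW y0] := leP y 0; first by rewrite clamp_le0// lexx ler01.
have [y1|/ltW y1] := leP y 1; first by rewrite clamp_id// y0.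
by rewrite clamp_ge1// ler01 lexx.
Qed.

Lemma continuous_clamp : continuous clamp.
Proof.
move=> y; apply: cvgMl; apply: cvgD; last exact: cvg_cst.
apply: cvgB; first by apply: cvg_norm; exact: cvg_id.
by apply: cvg_norm; apply: cvgB; [exact: cvg_id|exact: cvg_cst].
Qed.

Definition cutoff N x : R := clamp (N + 1 - `|x|).

Lemma continuous_cutoff N : continuous (cutoff N).
Proof.
move=> x; apply: (@continuous_comp _ _ _ (fun x => N + 1 - `|x|) clamp).
  by apply: cvgB; [exact: cvg_cst|apply: cvg_norm; exact: cvg_id].
exact: continuous_clamp.
Qed.

Lemma cutoff_in N x : `|x| <= N -> cutoff N x = 1.
Proof. by move=> xN; rewrite /cutoff clamp_ge1//; lra. Qed.

Lemma cutoff_out N x : N + 1 < `|x| -> cutoff N x = 0.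
Proof. by move=> xN; rewrite /cutoff clamp_le0//; lra. Qed.

Lemma compactly_supported_cutoff N f : continuous f ->
  compactly_supported (N + 1) (fun x => cutoff N x * f x).
Proof.
move=> cf; split; last by move=> x xN; rewrite cutoff_out// mul0r.
by move=> x; apply: cvgM; [exact: continuous_cutoff|exact: cf].
Qed.

(** Cutting off a function that vanishes at infinity changes it uniformly
little. *)
Lemma vague_convergence_vanishing (m_ : nat -> fmeas * fmeas) m C f :
  (forall n, smass (m_ n) <= C) -> vague_convergence m_ m ->
  bmf f -> continuous f ->
  (forall e, 0 < e -> exists N, forall x, N < `|x| -> `|f x| <= e) ->
  sint (m_ n) f @[n --> \oo] --> sint m f.
Proof.
move=> mC vc bf cf f0; apply: (cvg_sint_approx mC) => // e e0.
have [N NP] := f0 _ e0.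
have cc := compactly_supported_cutoff N cf.
exists (fun x => cutoff N x * f x); split; first exact: compactly_supported_bmf cc.
- move=> x; have [xN|xN] := leP `|x| N.
    by rewrite cutoff_in// mul1r subrr normr0 ltW.
  rewrite (_ : _ - _ = (1 - cutoff N x) * f x); last by ring.
  have /andP[c0 c1] := clamp_itv (N + 1 - `|x|).
  rewrite normrM (le_trans _ (NP x xN))// ler_piMl// ger0_norm ?subr_ge0//.
  by rewrite lerBlDr lerDl.
- exact: vc cc.
Qed.

(** [2 (1 - cos (h x)) (1 + x ^ 2) / x ^ 2], written without division.  The second
difference of step [h], in [t], of the Levy integrand is this weight times
[- exp (i t x)]. *)
Definition levy_weight h x : R :=
  2 * (h ^+ 2 * wker (h * x)) + 2 * (1 - cos (h * x)).

Lemma continuous_wker_mul h : continuous (fun x => wker (h * x)).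
Proof.
move=> x; apply: (@continuous_comp _ _ _ ( *%R h) wker).
  by apply: cvgM; [exact: cvg_cst|exact: cvg_id].
exact: continuous_wker.
Qed.

Lemma continuous_cos_mul h : continuous (fun x => cos (h * x)).
Proof.
move=> x; apply: (@continuous_comp _ _ _ ( *%R h) cos).
  by apply: cvgM; [exact: cvg_cst|exact: cvg_id].
exact: continuous_cos.
Qed.

Lemma continuous_sin_mul h : continuous (fun x => sin (h * x)).
Proof.
move=> x; apply: (@continuous_comp _ _ _ ( *%R h) sin).
  by apply: cvgM; [exact: cvg_cst|exact: cvg_id].
exact: continuous_sin.
Qed.

Lemma continuous_levy_weight h : continuous (levy_weight h).
Proof.
move=> x; apply: cvgD; (apply: cvgM; first exact: cvg_cst).
  by apply: cvgM; [exact: cvg_cst|exact: continuous_wker_mul].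
by apply: cvgB; [exact: cvg_cst|exact: continuous_cos_mul].
Qed.

Lemma levy_weight_ge0 h x : 0 <= levy_weight h x.
Proof.
by rewrite /levy_weight addr_ge0// mulr_ge0// ?one_sub_cos_ge0//
  mulr_ge0 ?sqr_ge0// wker_ge0.
Qed.

Lemma levy_weight_le h x : `|levy_weight h x| <= h ^+ 2 + 4.
Proof.
rewrite ger0_norm ?levy_weight_ge0// /levy_weight lerD//.
  have := wker_le (h * x); have := sqr_ge0 h => h0 hw.
  by have := ler_wpM2l h0 hw; lra.
by have := cos_geN1 (h * x); lra.
Qed.

Lemma bmf_levy_weight h : bmf (levy_weight h).
Proof. exact: (bmf_continuous (@continuous_levy_weight h) (levy_weight_le h)). Qed.

Lemma levy_weightE h x : levy_weight h x =
  2 * h ^+ 2 * wker (h * x) * (1 + x ^+ 2).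
Proof. by rewrite /levy_weight -wkerE exprMn; ring. Qed.

(** A test function is divided by the weight before the Fourier criterion is
applied.  The weight vanishes at the nonzero multiples of [2 pi / h], so [h] is
chosen small according to the support of the test function. *)
Lemma vague_convergence_fourier (m_ : nat -> fmeas * fmeas) m C :
  (forall n, smass (m_ n) <= C) ->
  (forall h t, sint (m_ n) (fun x => cos (t * x) * levy_weight h x)
     @[n --> \oo] --> sint m (fun x => cos (t * x) * levy_weight h x)) ->
  (forall h t, sint (m_ n) (fun x => sin (t * x) * levy_weight h x)
     @[n --> \oo] --> sint m (fun x => sin (t * x) * levy_weight h x)) ->
  vague_convergence m_ m.
Proof.
move=> mC hc hs N g cg.
pose h : R := (`|N| + 1)^-1.
have h0 : 0 < h by rewrite invr_gt0 ltr_wpDl.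
pose c : R := 2 * h ^+ 2 * (3 / 8).
have c0 : 0 < c by rewrite /c !mulr_gt0 ?exprn_gt0// divr_gt0.
(* the maximum of the weight and c: positive everywhere, and equal to the
   weight on the support of g *)
pose q x : R := (levy_weight h x + c + `|levy_weight h x - c|) / 2.
have q0 x : 0 < q x.
  have := ler_norm (- (levy_weight h x - c)); rewrite normrN => h1.
  by rewrite /q; have := levy_weight_ge0 h x; lra.
have cq : continuous q.
  move=> x; apply: cvgMl; apply: cvgD.
    by apply: cvgD; [exact: continuous_levy_weight|exact: cvg_cst].
  by apply: cvg_norm; apply: cvgB; [exact: continuous_levy_weight|exact: cvg_cst].
have cgq : compactly_supported N (fun x => g x / q x).
  split; last by move=> x xN; rewrite cg.2// mul0r.
  move=> x; apply: cvgM; first exact: cg.1.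
  by apply: cvgV; [rewrite gt_eqF|exact: cq].
have E : g = (fun x => g x / q x * levy_weight h x).
  apply/funext => x; have [xN|xN] := leP `|x| N; last by rewrite cg.2// !mul0r.
  suff -> : q x = levy_weight h x.
    rewrite divfK//; rewrite levy_weightE; have x2 := sqr_ge0 x.
    rewrite !mulf_neq0 ?gt_eqF ?exprn_gt0//; last by rewrite ltr_pwDl.
    rewrite (lt_le_trans _ (wker_ge _)) ?divr_gt0//.
    rewrite normrM (gtr0_norm h0) mulrC ler_pdivrMr ?ltr_wpDl// mul1r.
    by rewrite (le_trans xN)// (le_trans (ler_norm _))// lerDl.
  rewrite /q ger0_norm; first by field.
  rewrite subr_ge0 levy_weightE /c (@le_trans _ _ (2 * h ^+ 2 * wker (h * x)))//.
    apply: ler_wpM2l; first by rewrite mulr_ge0// sqr_ge0.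
    apply: wker_ge.
    rewrite normrM (gtr0_norm h0) mulrC ler_pdivrMr ?ltr_wpDl// mul1r.
    by rewrite (le_trans xN)// (le_trans (ler_norm _))// lerDl.
  by rewrite ler_peMr ?lerDl ?sqr_ge0// mulr_ge0 ?wker_ge0// mulr_ge0 ?sqr_ge0.
rewrite E.
exact: (@cvg_sint_compact _ m_ m C _ _ N mC (bmf_levy_weight h) cgq (hc h) (hs h)).
Qed.

(** Mass may escape to infinity under vague convergence.  The total (signed)
mass is nevertheless recovered from the weights: [1 - cos (h x)] is a weight up
to a function vanishing at infinity, and averaging it in [h] against the Fejer
kernel produces a constant up to a tent. *)
Lemma cvg_total_mass (m_ : nat -> fmeas * fmeas) m C :
  (forall n, smass (m_ n) <= C) -> vague_convergence m_ m ->
  (forall h, sint (m_ n) (levy_weight h) @[n --> \oo] --> sint m (levy_weight h)) ->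
  sint (m_ n) (fun=> 1) @[n --> \oo] --> sint m (fun=> 1).
Proof.
move=> mC vc hw.
pose s h x : R := 2 * (h ^+ 2 * wker (h * x)).
have s0 h x : 0 <= s h x by rewrite /s mulr_ge0// mulr_ge0 ?sqr_ge0// wker_ge0.
have cs h : continuous (s h).
  move=> x; apply: cvgM; first exact: cvg_cst.
  by apply: cvgM; [exact: cvg_cst|exact: continuous_wker_mul].
have bs h : bmf (s h).
  apply: (@bmf_continuous _ _ (h ^+ 2)) => // x.
  rewrite ger0_norm// /s.
  by have := ler_wpM2l (sqr_ge0 h) (wker_le (h * x)); lra.
have sc h : sint (m_ n) (s h) @[n --> \oo] --> sint m (s h).
  apply: (vague_convergence_vanishing mC vc) => // e e0.
  exists (Num.sqrt (4 / e)) => x xe; rewrite ger0_norm// /s.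
  have x2 : 4 / e < x ^+ 2.
    rewrite -[x ^+ 2]real_normK ?num_real// -[4 / e]sqr_sqrtr ?divr_ge0 ?(ltW e0)//.
    by rewrite ltrXn2r// sqrtr_ge0.
  have xx : 0 < x ^+ 2 by rewrite (lt_trans _ x2)// divr_gt0.
  rewrite -(ler_pM2l xx) (@le_trans _ _ 4)//.
    have := wkerE (h * x); rewrite exprMn => hE.
    by have := cos_geN1 (h * x); lra.
  by rewrite -ler_pdivrMr// ltW.
pose k t x : R := 1 - cos (t * x).
have bk t : bmf (k t) by apply: bmfB; [exact: bmf_cst|exact: bmf_cos].
have kc t : sint (m_ n) (k t) @[n --> \oo] --> sint m (k t).
  have E mm : sint mm (k t) = 2^-1 * (sint mm (levy_weight t) - sint mm (s t)).
    rewrite -sintB//; last exact: bmf_levy_weight.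
    rewrite -sintZ; last by apply: bmfB => //; exact: bmf_levy_weight.
    by congr sint; apply/funext => x; rewrite /levy_weight /s /k; field.
  rewrite E; under eq_fun do rewrite E.
  by apply: cvgM; [exact: cvg_cst|exact: cvgB].
have mk : measurable_fun [set: T * T] (fun z : T * T => k z.1 z.2).
  apply: measurable_funB; first exact: measurable_cst.
  have := measurable_cos_kernel 0 (bmf_cst (1 : R)).
  by apply: eq_measurable_fun => z _; rewrite subr0 mulr1.
have kM t x : `|k t x| <= 2.
  rewrite ger0_norm ?one_sub_cos_ge0// /k.
  by have := cos_geN1 (t * x); lra.
have bh : bmf (fun x : R => hat 1 (x - 0)) by exact: bmf_hat.
have mixE : mixture (fejer 1) k = (fun x => wmass * (2 - hat 1 (x - 0))).
  apply/funext => x; rewrite /mixture /k.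
  have i1 : lebesgue_measure.-integrable setT
      (EFin \o (fun t => fejer 1 t * cos (t * x))).
    apply: (le_integrable measurableT _ _ (integrable_fejer 1)).
      apply/measurable_EFinP; apply: measurable_funM.
        by apply/measurable_EFinP; exact: measurable_int (integrable_fejer 1).
      have [mc _] := bmf_cos x; move: mc.
      by apply: eq_measurable_fun => t _; rewrite mulrC.
    by move=> t _ /=; rewrite lee_fin normrM ler_piMr// cos_max.
  under eq_Rintegral do rewrite mulrBr mulr1.
  rewrite RintegralB//; last exact: integrable_fejer.
  have E0 : \int[@lebesgue_measure R]_t fejer 1 t = wmass * 2.
    have := fejer_cos 1 (0 : R).
    under eq_Rintegral do rewrite mulr0 cos0 mulr1.
    by move=> ->; congr (_ * _); rewrite /hat add0r sub0r normrN normr1 normr0; ring.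
  by rewrite fejer_cos E0 subr0 -mulrBr.
have c1 := cvg_sint_mixture (integrable_fejer 1) mk kM mC kc.
have b2 : bmf (fun x : R => 2 - hat 1 (x - 0)).
  by apply: bmfB => //; exact: bmf_cst.
have {}c1 : sint (m_ n) (fun x => 2 - hat 1 (x - 0)) @[n --> \oo]
    --> sint m (fun x => 2 - hat 1 (x - 0)).
  apply: (cvg_scale_inv (lt0r_neq0 wmass_gt0)).
  move: c1; rewrite mixE sintZ//; by under eq_fun do rewrite sintZ//.
have c2 : sint (m_ n) (fun x => hat 1 (x - 0)) @[n --> \oo]
    --> sint m (fun x => hat 1 (x - 0)).
  apply: (vc 1); split.
    rewrite (_ : (fun _ => _) = hat 1); first exact: continuous_hat.
    by apply/funext => y; rewrite subr0.
  by move=> x x1; rewrite subr0 hat_supp// ltW.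
have E mm : sint mm (fun=> 1) = 2^-1 * (sint mm (fun x => 2 - hat 1 (x - 0))
    + sint mm (fun x => hat 1 (x - 0))).
  rewrite -sintD// -sintZ; last exact: bmfD.
  by congr sint; apply/funext => x; field.
rewrite E; under eq_fun do rewrite E.
by apply: cvgM; [exact: cvg_cst|exact: cvgD].
Qed.

End VagueConvergence.

(** * Total mass of a Stieltjes charge *)

(** A named copy of a function, to attach the structure that Stieltjes measures
are built from. *)
Definition cumulative_of (R : realType) (f : R -> R) (nd : nondecreasing f)
  (rc : right_continuous f) : R -> R := f.
HB.instance Definition _ (R : realType) (f : R -> R) (nd : nondecreasing f)
  (rc : right_continuous f) :=
  isCumulative.Build R _ R (cumulative_of nd rc) nd rc.

Section StieltjesMass.
Context {R : realType}.
Notation T := (measurableTypeR R).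
Notation fmeas := {finite_measure set T -> \bar R}.
Notation TV := total_variation.

Lemma lebesgue_stieltjes_itv (c : cumulative R R) (a b : R) : a <= b ->
  lebesgue_stieltjes_measure c `]a, b]%classic = (c b - c a)%:E.
Proof.
move=> ab; rewrite /lebesgue_stieltjes_measure /measure_extension.
by rewrite measurable_mu_extE/=; [rewrite wlength_itv_bnd|exact: is_ocitv].
Qed.

(** All terms are moved to the side where they are nonnegative, so that two
measures, which agree on half-open intervals, are equal; [m1] is one of the two
summands. *)
Lemma lebesgue_stieltjes_le (c e : cumulative R R) (m1 m2 : fmeas) :
  (forall a b, a <= b ->
     ((c b - c a)%:E + m2 `]a, b]%classic = (e b - e a)%:E + m1 `]a, b]%classic)%E) ->
  forall A, measurable A -> (m1 A <= lebesgue_stieltjes_measure c A + m2 A)%E.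
Proof.
move=> H A mA.
pose mu1 := measure_add (lebesgue_stieltjes_measure c) m2.
pose mu2 := measure_add (lebesgue_stieltjes_measure e) m1.
have muE a b : mu1 `]a, b]%classic = mu2 `]a, b]%classic.
  have [ab|ba] := leP a b; last first.
    have -> : `]a, b]%classic = set0 :> set R.
      by apply: set_itv_ge; rewrite bnd_simp -leNgt ltW.
    by rewrite /mu1 /mu2 !measure_addE !measure0.
  rewrite /mu1 /mu2 !measure_addE; have := H _ _ ab.
  by rewrite -(lebesgue_stieltjes_itv c ab) -(lebesgue_stieltjes_itv e ab).
have -> : (lebesgue_stieltjes_measure c A + m2 A = mu1 A)%E by rewrite /mu1 measure_addE.
have -> : mu1 A = mu2 A; last by rewrite /mu2 measure_addE leeDr.
apply: (@measure_unique _ R T (@ocitv R)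
  (fun k => `](- k%:R), k%:R]%classic)) => //.
- exact: ocitvI.
- by move=> k; exact: is_ocitv.
- exact: bigcup_itvT.
- by move=> _ [[a b] _ <-]; exact: muE.
- move=> k; have kk : - k%:R <= k%:R :> R by rewrite (@le_trans _ _ 0)// oppr_le0.
  rewrite -[ltLHS]/(mu1 _) /mu1 measure_addE.
  rewrite -[X in (X + _)%E]/(lebesgue_stieltjes_measure c _).
  rewrite lebesgue_stieltjes_itv//.
  by rewrite lte_add_pinfty ?ltry// ltey_eq fin_num_measure.
Qed.

Variables (G : R -> R) (nu : {charge set T -> \bar R}).
Hypothesis VG : classV G.
Hypothesis nuG : is_stieltjes_charge G nu.

Let V := fine (total_variationR G).

Let TV_le a b : a <= b -> (TV a b G <= total_variationR G)%E.
Proof. by move=> ab; apply: ereal_sup_ubound; exists (a, b). Qed.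

Let TV_fin a b : a <= b -> TV a b G \is a fin_num.
Proof.
move=> ab; rewrite ge0_fin_numE ?total_variation_ge0//.
by apply: (le_lt_trans (TV_le ab)); have [] := VG.
Qed.

Let V_fin : total_variationR G \is a fin_num.
Proof.
rewrite ge0_fin_numE; first by have [] := VG.
exact: le_trans (total_variation_ge0 _ (lexx 0)) (TV_le (lexx 0)).
Qed.

(** The variation function, normalised at the origin instead of [-oo] so that
only variations over bounded intervals are involved. *)
Let W (x : R) : R := if 0 <= x then fine (TV 0 x G) else - fine (TV x 0 G).

Let W_inc a b : a <= b -> W b - W a = fine (TV a b G).
Proof.
move=> ab; rewrite /W; have [a0|a0] := leP 0 a.
- rewrite (le_trans a0 ab) (total_variationD G a0 ab) fineD ?TV_fin//.
  by rewrite addrC addKr.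
- have [b0|b0] := leP 0 b.
    by rewrite (total_variationD G (ltW a0) b0) fineD ?TV_fin ?(ltW a0)// opprK addrC.
  rewrite (total_variationD G ab (ltW b0)) fineD ?TV_fin ?(ltW b0)//.
  by rewrite opprK addrC addrK.
Qed.

Let W_ge a b : a <= b -> `|G b - G a| <= W b - W a.
Proof.
move=> ab; rewrite W_inc// -lee_fin fineK ?TV_fin//.
exact: total_variation_ge.
Qed.

Let W_rc : right_continuous W.
Proof.
move=> x; have xx : x < x + 1 by rewrite ltrDl.
have [_ rG _] := VG.
have bv : bounded_variation x (x + 1) G.
  by apply/(bounded_variationP _ (ltW xx)); apply: TV_fin; exact: ltW.
have := total_variation_right_continuous (lexx x) xx (rG x) bv.
rewrite total_variationxx/= => h.
have h' : W x + fine (TV x y G) @[y --> x^'+] --> W x + 0.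
  by apply: cvgD => //; exact: cvg_cst.
rewrite addr0 in h'; apply: cvg_trans h'; apply: near_eq_cvg.
near=> y; rewrite -W_inc; first by rewrite addrC subrK.
by apply: ltW; near: y; exact: nbhs_right_gt.
Unshelve. all: by end_near. Qed.

Let W_nd : nondecreasing W.
Proof. by move=> a b ab; rewrite -subr_ge0 (le_trans _ (W_ge ab)). Qed.

Let WB_nd : nondecreasing (fun x => W x - G x).
Proof.
by move=> a b ab; have := W_ge ab; rewrite ler_norml => /andP[_]; lra.
Qed.

Let WB_rc : right_continuous (fun x => W x - G x).
Proof.
by move=> x; apply: cvgB; [exact: W_rc|have [_ rG _] := VG; exact: rG].
Qed.

Let WD_nd : nondecreasing (fun x => W x + G x).
Proof.
by move=> a b ab; have := W_ge ab; rewrite ler_norml => /andP[+ _]; lra.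
Qed.

Let WD_rc : right_continuous (fun x => W x + G x).
Proof.
by move=> x; apply: cvgD; [exact: W_rc|have [_ rG _] := VG; exact: rG].
Qed.

Let cumW : cumulative R R := cumulative_of W_nd W_rc.
Let cumWB : cumulative R R := cumulative_of WB_nd WB_rc.
Let cumWD : cumulative R R := cumulative_of WD_nd WD_rc.

Let lambda := lebesgue_stieltjes_measure cumW.

Let lambda_setT : (lambda setT <= V%:E)%E.
Proof.
rewrite -(bigcup_itvT false false).
pose I n : set R := `]- (n%:R), n%:R]%classic.
have h : (lambda \o I) n @[n --> \oo] --> lambda (\bigcup_n I n).
  apply: nondecreasing_cvg_mu; rewrite /I//; first exact: bigcup_measurable.
  by move=> *; apply/subsetPset/subset_itv; rewrite leBSide/= ?lerN2 ler_nat.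
apply: (cvge_le _ h); apply: nearW => n /=.
have nn : - n%:R <= n%:R :> R by rewrite (@le_trans _ _ 0)// oppr_le0.
rewrite /lambda lebesgue_stieltjes_itv// /= W_inc// lee_fin.
by rewrite (fine_le _ V_fin) ?TV_fin ?TV_le.
Qed.

(** Both parts are dominated by the Stieltjes measure of the variation function
[W], because [W - G] and [W + G] are nondecreasing, and they live on
complementary sets. *)
Lemma jordan_mass_le (P N : set T) (PN : hahn_decomposition nu P N) :
  smass (jordan_pos PN : fmeas, jordan_neg PN : fmeas) <= V.
Proof.
have [[mP _] [mN _] PNT PN0] := PN.
have nuE a b : a <= b ->
   (jordan_pos PN `]a, b]%classic = (G b - G a)%:E + jordan_neg PN `]a, b]%classic)%E.
  move=> ab; rewrite -nuG// (jordan_decomp PN)//.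
  rewrite /cadd/= cscaleN1 subeK// fin_num_measure//.
have negP : jordan_neg PN P = 0%E.
  by rewrite jordan_negE cjordan_negE /crestr0 mem_set// /crestr PN0 charge0 oppe0.
have posN : jordan_pos PN N = 0%E.
  by rewrite jordan_posE cjordan_posE /crestr0 mem_set// /crestr setIC PN0 charge0.
have hP : (jordan_pos PN P <= lambda P)%E.
  rewrite -[leRHS]adde0 -negP.
  apply: (@lebesgue_stieltjes_le cumW cumWB) => // a b ab.
  rewrite -[X in _ = (_ + X)%E]/(jordan_pos PN `]a, b]%classic) nuE//= addeA -EFinD; congr (_%:E + _)%E.
  rewrite -[LHS]/(W b - W a) -[RHS]/(W b - G b - (W a - G a) + (G b - G a)); ring.
have hN : (jordan_neg PN N <= lambda N)%E.
  rewrite -[leRHS]adde0 -posN.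
  apply: (@lebesgue_stieltjes_le cumW cumWD) => // a b ab.
  rewrite -[X in (_ + X)%E = _]/(jordan_pos PN `]a, b]%classic) nuE//= addeA -EFinD; congr (_%:E + _)%E.
  rewrite -[RHS]/(W b + G b - (W a + G a)) -[LHS]/(W b - W a + (G b - G a)); ring.
have E (mu : {measure set T -> \bar R}) : (mu setT = mu P + mu N)%E.
  by rewrite -PNT measureU.
have e1 : jordan_pos PN setT = jordan_pos PN P.
  rewrite [LHS](E (jordan_pos PN)) -[X in (_ + X)%E]/(jordan_pos PN N).
  by rewrite posN adde0.
have e2 : jordan_neg PN setT = jordan_neg PN N.
  rewrite [LHS](E (jordan_neg PN)) -[X in (X + _)%E]/(jordan_neg PN P).
  by rewrite negP add0e.
rewrite -lee_fin (le_trans _ lambda_setT)//.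
rewrite [leRHS](E lambda) /smass/= e1 e2 EFinD.
by rewrite !fineK ?fin_num_measure//; exact: leeD.
Qed.

End StieltjesMass.

(** * Monotone functions and Helly selection *)

Section MonotoneFunctions.
Context {R : realType}.
Implicit Types (F : R -> R) (x : R).

Lemma discontinuity_countableT F : nondecreasing F ->
  countable [set x | discontinuity F x].
Proof.
move=> ndF; apply: (@sub_countable _ _ _ (\bigcup_(n in [set: nat])
    [set x | x \in (`](- n%:R), n%:R[) /\ discontinuity F x])).
  apply: subset_card_le => x dx; exists (Num.truncn `|x|).+1 => //=; split => //.
  by rewrite in_itv/= -ltr_norml truncnS_gt.
apply: bigcup_countable; first exact: countableP.
move=> n _; apply: discontinuity_countable => a b _ _; exact: ndF.
Qed.

Lemma continuity_small_increment F x (e : R) : nondecreasing F ->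
  ~ discontinuity F x -> 0 < e -> exists a b : R, [/\ a < x, x < b & F b - F a < e].
Proof.
move=> ndF dx e0.
have cl : cvg (F y @[y --> x^'-]).
  apply: nondecreasing_at_left_is_cvgr.
    by near=> y => a b _ _; exact: ndF.
  near=> y; exists (F x) => _ [z /= + <-]; rewrite in_itv/= => /andP[_ zx].
  by apply: ndF; exact: ltW.
have cr : cvg (F y @[y --> x^'+]).
  apply: nondecreasing_at_right_is_cvgr.
    by near=> y => a b _ _; exact: ndF.
  near=> y; exists (F x) => _ [z /= + <-]; rewrite in_itv/= => /andP[xz _].
  by apply: ndF; exact: ltW.
have E : lim (F y @[y --> x^'-]) = lim (F y @[y --> x^'+]).
  by apply/eqP/negPn/negP => ne; exact: dx.
have e2 : 0 < e / 2 by rewrite divr_gt0.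
have /cvgrPdist_lt /(_ _ e2) hl := cl.
have /cvgrPdist_lt /(_ _ e2) hr := cr.
have [a [ax ha]] : exists a, a < x /\ `|lim (F y @[y --> x^'-]) - F a| < e / 2.
  near x^'- => a; exists a; split; near: a => //; exact: nbhs_left_lt.
have [b [xb hb]] : exists b, x < b /\ `|lim (F y @[y --> x^'+]) - F b| < e / 2.
  near x^'+ => b; exists b; split; near: b => //; exact: nbhs_right_gt.
exists a, b; split => //; move: ha hb; rewrite E !ltr_norml.
by move=> /andP[? ?] /andP[? ?]; lra.
Unshelve. all: by end_near. Qed.

Lemma nbhs_prod_topology (V : R -> R) (s : seq R) (e : R) : 0 < e ->
  nbhs (V : prod_topology (fun _ : R => R))
    [set f | forall i, i \in s -> `|V i - f i| < e].
Proof.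
move=> e0; elim: s => [|i s IH].
  exact: (@filterS _ (nbhs (V : prod_topology (fun _ : R => R))) _ setT _ _ filterT).
have h : nbhs (V : prod_topology (fun _ : R => R)) [set f | `|V i - f i| < e].
  exact: (@proj_continuous R (fun _ : R => R) i V _ (nbhsx_ballx (V i) e e0)).
pose Pr := prod_topology (fun _ : R => R); pose FF := @nbhs_filter Pr V.
apply: (@filterS _ (nbhs (V : Pr)) FF _ _ _ (@filterI _ (nbhs (V : Pr)) FF _ _ h IH)).
move=> f [/= fi fs] j.
by rewrite in_cons => /predU1P[->//|]; exact: fs.
Qed.

(** Compactness of the product of copies of [0, C] indexed by
the whole line yields a cluster point, which is a monotone function; the
subsequence can only be extracted along countably many coordinates. *)
Lemma helly_selection (F_ : nat -> R -> R) (C : R) (c : nat -> R) :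
  (forall n x, 0 <= F_ n x <= C) -> (forall n, nondecreasing (F_ n)) ->
  exists2 V : R -> R, nondecreasing V &
  exists2 psi : nat -> nat, increasing_seq psi &
    forall j, F_ (psi k) (c j) @[k --> \oo] --> V (c j).
Proof.
move=> FC ndF.
have cpt := @tychonoff R (fun _ : R => R) (fun=> `[0, C]%classic)
  (fun=> @segment_compact R 0 C).
have [|V [_ clV]] := cpt (F_ n @[n --> \oo]) _.
  by exists 0%N => // n _ i; rewrite /= in_itv/= FC.
have near_V (N : nat) (s : seq R) e : 0 < e ->
    exists n, (N <= n)%N /\ forall i, i \in s -> `|V i - F_ n i| < (e : R).
  move=> e0.
  have [|_ [[n /= Nn <-] ns]] := clV (F_ @` [set n | (N <= n)%N]) _ _
    (nbhs_prod_topology V s e0).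
    by exists N => // n /= Nn; exists n.
  by exists n.
exists V.
  move=> x y xy; apply/ler_addgt0Pr => e e0.
  have e2 : 0 < e / 2 by rewrite divr_gt0.
  have [n [_ nP]] := near_V 0 [:: x; y] _ e2.
  have := nP x; rewrite inE eqxx => /(_ isT); rewrite ltr_norml => /andP[_ hx].
  have := nP y; rewrite !inE eqxx orbT => /(_ isT); rewrite ltr_norml => /andP[hy _].
  by have := ndF n x y xy; lra.
have /choice [pick pickP] : forall kN : nat * nat, exists n, (kN.2 <= n)%N /\
    forall i, i \in [seq c j | j <- iota 0 kN.1] -> `|V i - F_ n i| < kN.1.+1%:R^-1.
  by move=> [k N]; apply: near_V; rewrite invr_gt0.
pose psi := fix psi k := if k is k'.+1 then pick (k, (psi k').+1) else pick (0, 0)%N.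
exists psi; first by apply/increasing_seqP => k; exact: (pickP (k.+1, (psi k).+1)).1.
have psiP k j : (j < k)%N -> `|V (c j) - F_ (psi k) (c j)| < k.+1%:R^-1.
  move=> jk.
  have ij : c j \in [seq c j | j <- iota 0 k] by apply: map_f; rewrite mem_iota.
  by case: k jk ij => // k jk ij; exact: (pickP (k.+1, (psi k).+1)).2.
move=> j; apply/cvgrPdist_lt => e e0; near=> k.
rewrite (lt_trans (psiP k j _))//; first by near: k; exact: nbhs_infty_gt.
near: k; exact: (near_infty_natSinv_lt (PosNum e0)).
Unshelve. all: by end_near. Qed.

End MonotoneFunctions.

(** * Vague convergence and convergence of increments *)

Section BasicVersusVague.
Context {R : realType}.
Notation T := (measurableTypeR R).
Notation fmeas := {finite_measure set T -> \bar R}.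
Implicit Types (G : R -> R) (m : fmeas * fmeas).

Definition stieltjes_pair m G : Prop :=
  forall a b, a <= b -> G b - G a = sint m \1_(`]a, b]).

Definition vmass m (A : set R) : R := fine (m.1 A) + fine (m.2 A).

Definition vdist m (x : R) : R := vmass m `]-oo, x]%classic.

Let fineD' (mu : fmeas) (A B : set R) : measurable (A : set T) ->
  measurable (B : set T) -> fine (mu A + mu B)%E = fine (mu A) + fine (mu B).
Proof. by move=> mA mB; rewrite fineD// fin_num_measure. Qed.

Lemma vmass_le m (A B : set R) : measurable (A : set T) ->
  measurable (B : set T) -> A `<=` B -> vmass m A <= vmass m B.
Proof.
by move=> mA mB AB; rewrite lerD// fine_le ?fin_num_measure// le_measure// inE.
Qed.

Lemma vdist_itv m a b : a <= b -> vmass m `]a, b]%classic = vdist m b - vdist m a.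
Proof.
move=> ab.
have E (mu : fmeas) : fine (mu `]-oo, b]%classic) =
    fine (mu `]-oo, a]%classic) + fine (mu `]a, b]%classic).
  rewrite -fineD'//; congr fine.
  rewrite -measureU//.
    by rewrite -itv_bndbnd_setU// bnd_simp.
  rewrite -subset0 => x [] /=; rewrite !in_itv/= => xa /andP[ax _].
  by move: (lt_le_trans ax xa); rewrite ltxx.
by rewrite /vdist /vmass !E; ring.
Qed.

Lemma vdist_nd m : nondecreasing (vdist m).
Proof.
move=> a b ab; apply: vmass_le => // x /=; rewrite !in_itv/= => xa.
exact: le_trans xa ab.
Qed.

Lemma vdist_bounds m x : 0 <= vdist m x <= smass m.
Proof.
by rewrite /vdist addr_ge0 ?fine_ge0//= (@vmass_le m _ setT).
Qed.

Lemma sint_indic m (A : set R) : measurable (A : set T) ->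
  sint m \1_A = fine (m.1 A) - fine (m.2 A).
Proof. by move=> mA; rewrite /sint /Rintegral !integral_indic// !setIT. Qed.

Lemma sint_le_vmass m f (A B : set R) : bmf f ->
  measurable (A : set T) -> measurable (B : set T) ->
  (forall x, `|f x| <= \1_A x + \1_B x) -> `|sint m f| <= vmass m A + vmass m B.
Proof.
move=> bf mA mB fAB.
have bA : bmf (\1_A : R -> R) by exact: bmf_indic.
have bB : bmf (\1_B : R -> R) by exact: bmf_indic.
have h (mu : fmeas) : `|\int[mu]_x f x| <= fine (mu A) + fine (mu B).
  apply: (le_trans (le_normr_Rintegral _ _)) => //; first exact: bmf_integrable.
  have -> : fine (mu A) + fine (mu B) = \int[mu]_x (\1_A x + \1_B x).
    rewrite RintegralD//; try exact: bmf_integrable.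
    by rewrite /Rintegral !integral_indic// !setIT.
  apply: le_Rintegral => //.
  - have [mf [N fN]] := bf.
    apply: (@bmf_integrable _ mu (fun x => `|f x|)); split.
      exact: measurableT_comp.
    by exists N => x; rewrite normr_id.
  - by apply: (@bmf_integrable _ mu (fun x => \1_A x + \1_B x)); exact: bmfD.
rewrite (le_trans (ler_normB _ _))//.
have -> : vmass m A + vmass m B =
  fine (m.1 A) + fine (m.1 B) + (fine (m.2 A) + fine (m.2 B)) by rewrite /vmass; ring.
exact: lerD.
Qed.

Lemma indic_itvoc (a b x : R) : \1_(`]a, b]) x = ((a < x) && (x <= b))%:R :> R.
Proof. by rewrite indicE mem_setE in_itv. Qed.

Lemma sum_indic_itvoc (s d x : R) (n : nat) : 0 <= d ->
  \sum_(j < n) \1_(`]s + j%:R * d, s + j.+1%:R * d]) x =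
  \1_(`]s, s + n%:R * d]) x :> R.
Proof.
move=> d0; elim: n => [|n IH].
  rewrite big_ord0 indic_itvoc mul0r addr0.
  by case: (ltP s x).
rewrite big_ord_recr/= IH !indic_itvoc.
have h0 : s <= s + n%:R * d by rewrite lerDl mulr_ge0.
have h1 : s + n%:R * d <= s + n.+1%:R * d by rewrite lerD2l ler_wpM2r// ler_nat.
have [xs|sx] := leP x (s + n%:R * d).
  by rewrite (le_trans xs h1) addr0.
by rewrite (le_lt_trans h0 sx) andbF add0r.
Qed.

Lemma countable_avoid (D : set R) (a b : R) : countable D -> a < b ->
  exists2 x, a < x < b & ~ D x.
Proof.
move=> cD ab; apply: contrapT => h.
have sub : `]a, b[%classic `<=` D.
  move=> x /=; rewrite in_itv/= => xab.
  by apply: contrapT => nDx; apply: h; exists x.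
have c : countable `]a, b[%classic by apply: sub_countable cD; exact: subset_card_le.
have := countable_lebesgue_measure0 c.
rewrite lebesgue_measure_itv/= lte_fin ab => /eqP.
by rewrite -EFinB eqe subr_eq0 gt_eqF.
Qed.

(** Step functions whose nodes avoid the exceptional set approximate any test
function uniformly, and their integrals are combinations of increments. *)
Lemma vague_of_increments (m_ : nat -> fmeas * fmeas) m (G_ : nat -> R -> R) G C
    (D : set R) :
  (forall n, smass (m_ n) <= C) ->
  (forall n, stieltjes_pair (m_ n) (G_ n)) -> stieltjes_pair m G ->
  countable D ->
  (forall x1 x2, ~ D x1 -> ~ D x2 ->
     G_ n x2 - G_ n x1 @[n --> \oo] --> G x2 - G x1) ->
  vague_convergence m_ m.
Proof.
move=> mC GE_ GE cD GD N g cg.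
apply: (cvg_sint_approx mC); first exact: compactly_supported_bmf cg.
move=> e e0; have [d d0 dP] := compactly_supported_unif cg e0.
(* a grid of step d avoids D as soon as its origin avoids the translates of D *)
have cD' : countable (\bigcup_(j in [set: nat]) ((fun x => x - j%:R * d) @` D)).
  apply: bigcup_countable; first exact: countableP.
  by move=> j _; apply: sub_countable cD; exact: card_image_le.
have NN : - N - 1 < - N by rewrite ltrBlDr ltrDl.
have [s /andP[s1 s2] sD] := countable_avoid cD' NN.
pose p (j : nat) : R := s + j%:R * d.
have pD j : ~ D (p j).
  by move=> Dp; apply: sD; exists j => //; exists (p j) => //; rewrite /p addrK.
have pp j : p j <= p j.+1.
  by rewrite /p lerD2l ler_wpM2r ?(ltW d0)// ler_nat.
pose w (j : nat) : R -> R := \1_(`]p j, p j.+1]).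
have bw j : bmf (w j) by exact: bmf_indic.
pose n0 := (Num.truncn ((N - s) / d)).+1.
have n0N : N <= s + n0%:R * d.
  by rewrite -lerBlDl -ler_pdivrMr// ltW// truncnS_gt.
have app : forall x, `|g x - \sum_(j < n0) g (p j) * w j x| <= e.
  apply: (@partition_of_unity_approx _ n0 w p g d) => //; first exact: ltW.
  - move=> x; rewrite sum_indic_itvoc; last exact: ltW.
    by rewrite indic_itvoc; case: (_ && _).
  - move=> x gx; rewrite sum_indic_itvoc; last exact: ltW.
    have xN : `|x| <= N by rewrite leNgt; apply: contra gx => Nx; rewrite cg.2.
    move: xN; rewrite ler_norml indic_itvoc => /andP[x1 x2].
    by rewrite (lt_le_trans s2 x1) (le_trans x2 n0N).
  - move=> j x; rewrite /w indic_itvoc pnatr_eq0 eqb0 negbK => /andP[x1 x2].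
    rewrite ger0_norm ?subr_ge0 ?(ltW x1)// lerBlDr (le_trans x2)//.
    by rewrite /p -natr1 mulrDl mul1r addrA addrC.
exists (fun x => \sum_(j < n0) g (p j) * w j x); split => //.
- by apply: (@bmf_sum _ _ _ (fun j : 'I_n0 => fun x => g (p j) * w j x)) => j; exact: bmfZ.
- have E mm : sint mm (fun x => \sum_(j < n0) g (p j) * w j x) =
      \sum_(j < n0) g (p j) * sint mm (w j).
    rewrite (@sint_sum _ _ _ _ (fun j : 'I_n0 => fun x => g (p j) * w j x)).
      by apply: eq_bigr => j _; rewrite sintZ.
    by move=> j; exact: bmfZ.
  rewrite E; under eq_fun do rewrite E.
  apply: cvg_sumr => j; apply: cvgM; first exact: cvg_cst.
  rewrite -GE//; under eq_fun do rewrite -GE_//.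
  exact: GD.
Qed.

Lemma increasing_seq_ge (psi : nat -> nat) k : increasing_seq psi -> (k <= psi k)%N.
Proof.
move=> /increasing_seqP ipsi; elim: k => // k IH.
by rewrite (leq_ltn_trans IH)//; exact: ipsi.
Qed.

Lemma cvg_subsequence (u : nat -> R) (l : R) (psi : nat -> nat) :
  increasing_seq psi -> u n @[n --> \oo] --> l -> u (psi k) @[k --> \oo] --> l.
Proof.
move=> ipsi ul; apply: (@cvg_comp _ _ _ psi u \oo \oo) => //.
move=> A [n _ nA]; exists n => // k /= nk; apply: nA => /=.
exact: leq_trans (increasing_seq_ge k ipsi).
Qed.

(** Helly selection, applied to the distribution functions of the variation
measures, singles out the countably many points near which variation
accumulates.  When the end points of an interval are not among them, its
indicator differs from a trapezoid by functions of small integral, uniformly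
along the subsequence. *)
Lemma increments_of_vague (m_ : nat -> fmeas * fmeas) m (G_ : nat -> R -> R) G C :
  (forall n, smass (m_ n) <= C) ->
  (forall n, stieltjes_pair (m_ n) (G_ n)) -> stieltjes_pair m G ->
  vague_convergence m_ m ->
  exists2 psi : nat -> nat, increasing_seq psi &
  exists2 D : set R, countable D & forall x1 x2, ~ D x1 -> ~ D x2 ->
    G_ (psi k) x2 - G_ (psi k) x1 @[k --> \oo] --> G x2 - G x1.
Proof.
move=> mC GE_ GE vc.
pose c (j : nat) : R := ratr (odflt 0 (unpickle j) : rat).
have FC n x : 0 <= vdist (m_ n) x <= C.
  by have /andP[-> h] := vdist_bounds (m_ n) x; rewrite (le_trans h).
have [V ndV [psi ipsi cV]] := helly_selection c FC (fun n => @vdist_nd (m_ n)).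
have cVq (q : rat) : vdist (m_ (psi k)) (ratr q) @[k --> \oo] --> V (ratr q).
  by have := cV (pickle q); rewrite /c pickleK.
exists psi => //.
pose F x := V x + vdist m x.
have ndF : nondecreasing F by move=> x y xy; rewrite lerD ?ndV ?vdist_nd.
exists [set x | discontinuity F x]; first exact: discontinuity_countableT.
suff H x1 x2 : x1 < x2 -> ~ discontinuity F x1 -> ~ discontinuity F x2 ->
    G_ (psi k) x2 - G_ (psi k) x1 @[k --> \oo] --> G x2 - G x1.
  move=> x1 x2 D1 D2; have [x12|x21|->] := ltgtP x1 x2; first exact: H.
    have E (f : R -> R) : f x2 - f x1 = - (f x1 - f x2) by rewrite opprB.
    rewrite E; under eq_fun do rewrite E.
    by apply: cvgN; exact: H.
  rewrite subrr; under eq_fun do rewrite subrr.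
  exact: cvg_cst.
move=> x12 D1 D2; apply/cvgrPdist_le => e e0.
have e5 : 0 < e / 5 by rewrite divr_gt0.
(* rational points around x between which both the limit of the variations and
   the variation of the limit are small *)
have around x : ~ discontinuity F x -> exists a b : rat,
    [/\ ratr a < x, x < ratr b, V (ratr b) - V (ratr a) < e / 5 &
        vdist m (ratr b) - vdist m (ratr a) < e / 5].
  move=> Dx; have [a [b [ax xb Fab]]] := continuity_small_increment ndF Dx e5.
  have [a' /[!in_itv]/= /andP[aa' a'x]] := rat_in_itvoo ax.
  have [b' /[!in_itv]/= /andP[xb' b'b]] := rat_in_itvoo xb.
  have ab : ratr a' <= ratr b' :> R by rewrite ltW// (lt_trans a'x).
  exists a', b'; split => //; move: Fab; rewrite /F.
  - have := ndV _ _ (ltW aa'); have := ndV _ _ (ltW b'b).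
    have := @vdist_nd m a b (ltW (lt_trans ax xb)); lra.
  - have := ndV _ _ (ltW (lt_trans ax xb)).
    have := @vdist_nd m _ _ (ltW aa'); have := @vdist_nd m _ _ (ltW b'b); lra.
have [a1 [b1 [a1x xb1 Vab1 mab1]]] := around _ D1.
have [a2 [b2 [a2x xb2 Vab2 mab2]]] := around _ D2.
(* a trapezoid, equal to the indicator of ]x1, x2] except near x1 and x2 *)
pose g (x : R) : R := clamp ((x - ratr a1) / (x1 - ratr a1))
  - clamp ((x - x2) / (ratr b2 - x2)).
have p1 : 0 < x1 - ratr a1 by rewrite subr_gt0.
have p2 : 0 < ratr b2 - x2 by rewrite subr_gt0.
have cg : continuous g.
  have ccl (u v : R) : continuous (fun x => clamp ((x - u) / v)).
    move=> x; apply: (@continuous_comp _ _ _ (fun x => (x - u) / v) clamp).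
      by apply: cvgMl; apply: cvgB; [exact: cvg_id|exact: cvg_cst].
    exact: continuous_clamp.
  by move=> x; apply: cvgB; exact: ccl.
have g_left x : x <= ratr a1 -> g x = 0.
  move=> xa; rewrite /g !clamp_le0 ?subrr// ler_pdivrMr// mul0r; last by lra.
  lra.
have g_right x : ratr b2 <= x -> g x = 0.
  move=> xb; rewrite /g !clamp_ge1 ?subrr// ler_pdivlMr// mul1r; last by lra.
  lra.
have g_mid x : x1 <= x <= x2 -> g x = 1.
  move=> /andP[xx1 xx2]; rewrite /g clamp_ge1; last first.
    by rewrite ler_pdivlMr// mul1r; lra.
  by rewrite clamp_le0 ?subr0// ler_pdivrMr// mul0r; lra.
have cs : compactly_supported (`|ratr a1| + `|ratr b2|) g.
  split => // x hx; have [xa|ax] := leP x (ratr a1); first exact: g_left.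
  have [bx|xb] := leP (ratr b2) x; first exact: g_right.
  exfalso; move: hx; apply/negP; rewrite -leNgt ler_norml.
  have := ler_norm (ratr b2 : R); have := ler_norm (- ratr a1 : R).
  rewrite normrN; have := normr_ge0 (ratr a1 : R); have := normr_ge0 (ratr b2 : R).
  by move=> *; apply/andP; split; lra.
have bg := compactly_supported_bmf cs.
have bi : bmf (\1_(`]x1, x2]) : R -> R) by exact: bmf_indic.
have g_app x : `|g x - \1_(`]x1, x2]) x| <=
    \1_(`]ratr a1, ratr b1]) x + \1_(`]ratr a2, ratr b2]) x.
  have i0 (a b : R) : 0 <= \1_(`]a, b]) x :> R by rewrite indic_itvoc.
  have /andP[k0 k1] := clamp_itv ((x - ratr a1) / (x1 - ratr a1)).
  have /andP[l0 l1] := clamp_itv ((x - x2) / (ratr b2 - x2)).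
  have [xa|ax] := leP x (ratr a1).
    rewrite g_left// indic_itvoc (ltNge x1) (le_trans xa (ltW a1x))/= subrr normr0.
    by rewrite addr_ge0.
  have [bx|xb] := ltP (ratr b2) x.
    rewrite g_right ?(ltW bx)// indic_itvoc (leNgt x) (lt_trans xb2 bx) andbF.
    by rewrite subrr normr0 addr_ge0.
  have [xx1|x1x] := leP x x1.
    rewrite [leRHS]addrC -lerBlDl (@le_trans _ _ 1)//; last first.
      by rewrite (indic_itvoc (ratr a1)) ax (le_trans xx1 (ltW xb1)).
    rewrite lerBlDr ler_wpDr//.
    rewrite indic_itvoc (ltNge x1) xx1/= subr0 /g.
    rewrite [clamp ((x - x2) / _)]clamp_le0; last first.
      by rewrite ler_pdivrMr// mul0r; lra.
    by rewrite subr0 ger0_norm.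
  have [xx2|x2x] := leP x x2.
    rewrite g_mid ?(ltW x1x)//= indic_itvoc x1x xx2 subrr normr0.
    by rewrite addr_ge0.
  rewrite ler_wpDl// (indic_itvoc (ratr a2)) xb (lt_trans a2x x2x)/=.
  rewrite indic_itvoc (leNgt x) x2x andbF subr0 /g clamp_ge1; last first.
    by rewrite ler_pdivlMr// mul1r; lra.
  by rewrite ger0_norm ?subr_ge0// lerBlDr lerDl.
have err mm GG : stieltjes_pair mm GG ->
    `|sint mm g - (GG x2 - GG x1)| <= (vdist mm (ratr b1) - vdist mm (ratr a1))
       + (vdist mm (ratr b2) - vdist mm (ratr a2)).
  move=> h; rewrite (h _ _ (ltW x12)) -sintB//.
  rewrite -!vdist_itv ?(ltW (lt_trans a1x xb1)) ?(ltW (lt_trans a2x xb2))//.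
  by apply: sint_le_vmass => //; exact: bmfB.
have /cvgrPdist_le /(_ _ e5) hg := cvg_subsequence ipsi (vc _ _ cs).
have hV1 : \forall k \near \oo,
    vdist (m_ (psi k)) (ratr b1) - vdist (m_ (psi k)) (ratr a1) < e / 5.
  exact: (cvgr_lt _ (cvgB (cVq b1) (cVq a1))).
have hV2 : \forall k \near \oo,
    vdist (m_ (psi k)) (ratr b2) - vdist (m_ (psi k)) (ratr a2) < e / 5.
  exact: (cvgr_lt _ (cvgB (cVq b2) (cVq a2))).
near=> k.
have h1 : `|sint m g - sint (m_ (psi k)) g| <= e / 5 by near: k.
have h2 : vdist (m_ (psi k)) (ratr b1) - vdist (m_ (psi k)) (ratr a1) < e / 5.
  by near: k.
have h3 : vdist (m_ (psi k)) (ratr b2) - vdist (m_ (psi k)) (ratr a2) < e / 5.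
  by near: k.
have h4 := err _ _ GE; have h5 := err _ _ (GE_ (psi k)).
rewrite (_ : _ - _ = (sint m g - sint (m_ (psi k)) g) -
  (sint m g - (G x2 - G x1)) +
  (sint (m_ (psi k)) g - (G_ (psi k) x2 - G_ (psi k) x1))); last by ring.
rewrite (le_trans (ler_normD _ _))//.
have := ler_normB (sint m g - sint (m_ (psi k)) g) (sint m g - (G x2 - G x1)).
move: h1 h2 h3 h4 h5 mab1 mab2.
set u1 := `|_|; set u2 := `|_|; set u3 := `|_|; set u4 := `|_|.
lra.
Unshelve. all: by end_near. Qed.

End BasicVersusVague.

(** * The exponent of a spectral pair *)

Section LevyIntegrand.
Context {R : realType}.
Notation T := (measurableTypeR R).
Notation fmeas := {finite_measure set T -> \bar R}.
Implicit Types (x y t h : R) (m : fmeas * fmeas).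

(** The continuous extension of [(sin y - y) / y ^ 2], in which the imaginary part
of the Levy integrand is expressed near the origin. *)
Definition sker (y : R) : R := if y == 0 then 0 else (sin y - y) / y ^+ 2.

Lemma skerE y : y ^+ 2 * sker y = sin y - y.
Proof.
rewrite /sker; case: eqVneq => [->|y0]; first by rewrite mulr0 sin0 subrr.
by rewrite mulrC divfK// sqrf_eq0.
Qed.

Lemma sker_le y : `|sker y| <= 1.
Proof.
rewrite /sker; case: eqVneq => [_|y0]; first by rewrite normr0.
have y2 : 0 < y ^+ 2 by rewrite exprn_even_gt0.
rewrite normrM normfV (gtr0_norm y2) ler_pdivrMr// mul1r distrC.
exact: sub_sin_le.
Qed.

Lemma sker_le_norm y : `|sker y| <= `|y|.
Proof.
rewrite /sker; case: eqVneq => [->|y0]; first by rewrite normr0.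
have y2 : 0 < y ^+ 2 by rewrite exprn_even_gt0.
rewrite normrM normfV (gtr0_norm y2) ler_pdivrMr// distrC.
rewrite (le_trans (sub_sin_le3 y))// -(@real_normK _ y) ?num_real// -exprS.
by rewrite ler_pdivrMr// ler_peMr ?exprn_ge0// ler1n.
Qed.

Lemma continuous_sker : continuous sker.
Proof.
move=> y; have [->|y0] := eqVneq y 0.
  rewrite /continuous_at {2}/sker eqxx; apply/cvgrPdist_lt => e e0.
  exists e => //= x; rewrite !sub0r !normrN => xe.
  apply: le_lt_trans (sker_le_norm x) _.
  by move: xe; rewrite /ball_/= sub0r normrN.
have: {for y, continuous (fun y => (sin y - y) / y ^+ 2)}.
  apply: cvgM.
    by apply: cvgB; [exact: continuous_sin|exact: cvg_id].
  by apply: cvgV; [rewrite sqrf_eq0|exact: exprn_continuous].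
rewrite /prop_for /continuous_at {2}/sker (negbTE y0).
apply: cvg_trans; apply: near_eq_cvg.
near=> x; rewrite /sker ifF//; apply/negbTE.
by near: x; apply: (@cvgr_neq0 _ _ _ _ _ id y) => //; exact: cvg_id.
Unshelve. all: by end_near. Qed.

Variable tau : R.
Hypothesis tau0 : 0 < tau.

(** Real and imaginary parts of the Levy integrand, in a form without division by
[x] that is visibly bounded and continuous. *)
Definition levy_re t x : R := - (levy_weight t x / 2).

Definition levy_im t x : R :=
  t ^+ 2 * sker (t * x) - t * tau * sker (tau * x)
  + (sin (t * x) - t / tau * sin (tau * x)).

Lemma levy_reE t x : x != 0 ->
  levy_re t x = (cos (t * x) - 1) * ((1 + x ^+ 2) / x ^+ 2).
Proof.
move=> x0; rewrite /levy_re levy_weightE.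
have := wkerE (t * x); rewrite exprMn => E.
have -> : cos (t * x) - 1 = - (t ^+ 2 * x ^+ 2 * wker (t * x)) by rewrite E; ring.
by field.
Qed.

Lemma levy_re0 t : levy_re t 0 = - (t ^+ 2 / 2).
Proof. by rewrite /levy_re levy_weightE mulr0 /wker eqxx; field. Qed.

Lemma levy_imE t x : x != 0 -> levy_im t x =
  (sin (t * x) - t / tau * sin (tau * x)) * ((1 + x ^+ 2) / x ^+ 2).
Proof.
move=> x0; rewrite /levy_im.
have h1 := skerE (t * x); have h2 := skerE (tau * x).
rewrite !exprMn in h1 h2.
have -> : sin (t * x) = t ^+ 2 * x ^+ 2 * sker (t * x) + t * x by rewrite h1; ring.
have -> : sin (tau * x) = tau ^+ 2 * x ^+ 2 * sker (tau * x) + tau * x.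
  by rewrite h2; ring.
by field; rewrite x0 gt_eqF.
Qed.

Lemma levy_im0 t : levy_im t 0 = 0.
Proof. by rewrite /levy_im !mulr0 sin0 /sker eqxx; ring. Qed.

(** This is what makes the drift visible: with this centring, the exponent at
[tau] does not depend on the measure. *)
Lemma levy_im_tau x : levy_im tau x = 0.
Proof. by rewrite /levy_im divff ?gt_eqF//; ring. Qed.

Lemma levy_im_zero x : levy_im 0 x = 0.
Proof. by rewrite /levy_im !mul0r sin0; ring. Qed.

Lemma skerN y : sker (- y) = - sker y.
Proof. by rewrite /sker oppr_eq0; case: ifP => _; rewrite ?oppr0// sinN sqrrN; ring. Qed.

Lemma levy_imN t x : levy_im (- t) x = - levy_im t x.
Proof. by rewrite /levy_im mulNr skerN sinN; ring. Qed.

Lemma levy_re_diff2 t h x :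
  levy_re (t + h) x + levy_re (t - h) x - 2 * levy_re t x
  = - (cos (t * x) * levy_weight h x).
Proof.
have [->|x0] := eqVneq x 0.
  by rewrite !levy_re0 mulr0 cos0 levy_weightE mulr0 /wker eqxx; field.
have -> : levy_weight h x = - 2 * levy_re h x by rewrite /levy_re; field.
rewrite !levy_reE// [(t + h) * x]mulrDl [(t - h) * x]mulrBl cosD cosB.
by field.
Qed.

Lemma levy_im_diff2 t h x :
  levy_im (t + h) x + levy_im (t - h) x - 2 * levy_im t x
  = - (sin (t * x) * levy_weight h x).
Proof.
have [->|x0] := eqVneq x 0; first by rewrite !levy_im0 !mulr0 sin0; ring.
have -> : levy_weight h x = - 2 * levy_re h x by rewrite /levy_re; field.
rewrite !levy_imE// levy_reE// [(t + h) * x]mulrDl [(t - h) * x]mulrBl sinD sinB.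
by field; rewrite x0 gt_eqF.
Qed.

Lemma bmf_levy_re t : bmf (levy_re t).
Proof.
rewrite (_ : levy_re t = (fun x => - 2^-1 * levy_weight t x)).
  by apply: bmfZ; exact: bmf_levy_weight.
by apply/funext => x; rewrite /levy_re; field.
Qed.

Lemma sint_levy_re m t : sint m (levy_re t) = - 2^-1 * sint m (levy_weight t).
Proof.
rewrite -sintZ; last exact: bmf_levy_weight.
by congr sint; apply/funext => x; rewrite /levy_re; field.
Qed.

Lemma levy_im_le t x (K : R) : `|t| <= K ->
  `|levy_im t x| <= K ^+ 2 + K * tau + (1 + K / tau).
Proof.
move=> tK; have K0 : 0 <= K := le_trans (normr_ge0 t) tK.
rewrite /levy_im (le_trans (ler_normD _ _))//; apply: lerD.
  rewrite (le_trans (ler_normB _ _))// !normrM (gtr0_norm tau0) lerD//.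
    rewrite -[leRHS]mulr1 ler_pM ?sker_le//.
    by rewrite expr2 ler_pM.
  by rewrite -[leRHS]mulr1 ler_pM ?mulr_ge0 ?(ltW tau0) ?sker_le// ler_pM2r.
rewrite (le_trans (ler_normB _ _))// lerD// ?sin_max// !normrM normfV (gtr0_norm tau0).
rewrite -[leRHS]mulr1 ler_pM ?sin_max ?mulr_ge0 ?invr_ge0 ?(ltW tau0)//.
by rewrite ler_pM2r ?invr_gt0.
Qed.

Let continuous_mul (a : R) (f : R -> R) : continuous f -> continuous (fun x => f (a * x)).
Proof.
move=> cf x; apply: (@continuous_comp _ _ _ ( *%R a) f); last exact: cf.
by apply: cvgM; [exact: cvg_cst|exact: cvg_id].
Qed.

Lemma continuous_levy_im t : continuous (levy_im t).
Proof.
move=> x; apply: cvgD; apply: cvgB; [|..|].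
- by apply: cvgM; [exact: cvg_cst|exact/continuous_mul/continuous_sker].
- by apply: cvgM; [exact: cvg_cst|exact/continuous_mul/continuous_sker].
- exact/continuous_mul/continuous_sin.
- by apply: cvgM; [exact: cvg_cst|exact/continuous_mul/continuous_sin].
Qed.

Lemma bmf_levy_im t : bmf (levy_im t).
Proof.
exact: (bmf_continuous (@continuous_levy_im t) (fun x => levy_im_le x (lexx `|t|))).
Qed.

Lemma continuous_levy_im_param x : continuous (levy_im^~ x).
Proof.
have E : levy_im^~ x = (fun t => t ^+ 2 * sker (x * t) - t * tau * sker (tau * x)
   + (sin (x * t) - t / tau * sin (tau * x))).
  by apply/funext => t; rewrite /levy_im [t * x]mulrC.
rewrite E => t; apply: cvgD; apply: cvgB; [|..|].
- by apply: cvgM; [exact: exprn_continuous|exact/continuous_mul/continuous_sker].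
- by apply: cvgMl; apply: cvgMl; exact: cvg_id.
- exact/continuous_mul/continuous_sin.
- by apply: cvgMl; apply: cvgMl; exact: cvg_id.
Qed.

Definition expo_re m t : R := sint m (levy_re t).

Definition expo_im m (gamma t : R) : R := t * gamma + sint m (levy_im t).

Lemma continuous_expo_im m gamma : continuous (expo_im m gamma).
Proof.
move=> t; apply: cvgD; first by apply: cvgMl; exact: cvg_id.
apply/(@cvg_nbhsP _ R^o) => u ut.
have [M [_ hM]] := cvg_seq_bounded (cvgP _ ut).
have uM n : `|u n| <= M + 1.
  by apply: hM => //; rewrite ltrDl.
apply: (@sint_dct _ _ _ _ ((M + 1) ^+ 2 + (M + 1) * tau + (1 + (M + 1) / tau))).
- by move=> n; exact: bmf_levy_im.
- by move=> n x; exact: levy_im_le.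
- by move=> x; apply: (@cvg_comp _ _ _ u (levy_im^~ x) _ _ _ ut);
  exact: continuous_levy_im_param.
Qed.

Lemma expo_im_tau m gamma : expo_im m gamma tau = tau * gamma.
Proof.
rewrite /expo_im (_ : levy_im tau = (fun=> 0)); last first.
  by apply/funext => x; exact: levy_im_tau.
by rewrite sint_cst mul0r addr0.
Qed.

Lemma expo_im0 m gamma : expo_im m gamma 0 = 0.
Proof.
rewrite /expo_im (_ : levy_im 0 = (fun=> 0)); last first.
  by apply/funext => x; exact: levy_im_zero.
by rewrite sint_cst !mul0r addr0.
Qed.

Lemma expo_imN m gamma t : expo_im m gamma (- t) = - expo_im m gamma t.
Proof.
rewrite /expo_im (_ : levy_im (- t) = (fun x => -1 * levy_im t x)); last first.
  by apply/funext => x; rewrite levy_imN mulN1r.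
by rewrite sintZ; [ring|exact: bmf_levy_im].
Qed.

(** Second differences remove the drift and the centring, and leave, up to sign,
the Fourier transform of the measure weighted by [levy_weight]. *)
Lemma expo_re_diff2 m t h :
  expo_re m (t + h) + expo_re m (t - h) - 2 * expo_re m t
  = - sint m (fun x => cos (t * x) * levy_weight h x).
Proof.
have b := bmf_levy_re.
have e1 := sintD m (b (t + h)) (b (t - h)); have e2 := sintZ m 2 (b t).
rewrite /expo_re -e1 -e2 -sintB; [|exact: bmfD|exact: bmfZ].
rewrite -[RHS]mulN1r -sintZ; last first.
  by apply: bmfM; [exact: bmf_cos|exact: bmf_levy_weight].
by congr sint; apply/funext => x; rewrite levy_re_diff2 mulN1r.
Qed.

Lemma expo_im_diff2 m gamma t h :
  expo_im m gamma (t + h) + expo_im m gamma (t - h) - 2 * expo_im m gamma t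
  = - sint m (fun x => sin (t * x) * levy_weight h x).
Proof.
transitivity (sint m (levy_im (t + h)) + sint m (levy_im (t - h))
   - 2 * sint m (levy_im t)); first by rewrite /expo_im; ring.
have b := bmf_levy_im.
have e1 := sintD m (b (t + h)) (b (t - h)); have e2 := sintZ m 2 (b t).
rewrite -e1 -e2 -sintB; [|exact: bmfD|exact: bmfZ].
rewrite -[RHS]mulN1r -sintZ; last first.
  by apply: bmfM; [exact: bmf_sin|exact: bmf_levy_weight].
by congr sint; apply/funext => x; rewrite levy_im_diff2 mulN1r.
Qed.

Lemma expo_re_ge m C t K : smass m <= C -> `|t| <= K ->
  - ((K ^+ 2 + 4) * C) <= expo_re m t.
Proof.
move=> mC tK; have K0 : 0 <= K := le_trans (normr_ge0 t) tK.
have : `|expo_re m t| <= (K ^+ 2 + 4) * smass m.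
  apply: sint_le => [|x]; first exact: bmf_levy_re.
  rewrite /levy_re normrN normrM normfV (ger0_norm (_ : 0 <= 2))//.
  rewrite ler_pdivrMr// (le_trans (levy_weight_le t x))//.
  have : t ^+ 2 <= K ^+ 2 by rewrite -[t ^+ 2]real_normK ?num_real// lerXn2r.
  by have := sqr_ge0 K; lra.
rewrite ler_norml => /andP[h _]; apply: le_trans h.
by rewrite lerN2 ler_wpM2l// addr_ge0// sqr_ge0.
Qed.

End LevyIntegrand.

(** * Equicontinuity of characteristic functions *)

Section CharacteristicFunctions.
Context {R : realType}.
Notation T := (measurableTypeR R).
Notation fmeas := {finite_measure set T -> \bar R}.
Notation cdf := (cumulativeBounded (0 : R) (1 : R)).

Definition cdf_pair (F : cdf) : fmeas * fmeas :=
  (lebesgue_stieltjes_measure F : fmeas, mzero : fmeas).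

Lemma sint_cdf_pair F g : sint (cdf_pair F) g = \int[lebesgue_stieltjes_measure F]_x g x.
Proof. by rewrite /sint/= {2}/Rintegral integral_measure_zero subr0. Qed.

Lemma smass_cdf_pair F : smass (cdf_pair F) = 1.
Proof.
rewrite /smass/= [X in fine X](@probability_setT _ _ R (lebesgue_stieltjes_measure F)).
by rewrite /mzero addr0.
Qed.

Definition char_cos (F : cdf) (t : R) := sint (cdf_pair F) (fun x => cos (t * x)).
Definition char_sin (F : cdf) (t : R) := sint (cdf_pair F) (fun x => sin (t * x)).

Lemma weak_convergence_sint F_ F (h : R -> R) M : weak_convergence F_ F ->
  continuous h -> (forall x, `|h x| <= M) ->
  sint (cdf_pair (F_ n)) h @[n --> \oo] --> sint (cdf_pair F) h.
Proof.
move=> w ch hM; rewrite sint_cdf_pair; under eq_fun do rewrite sint_cdf_pair.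
apply: w => //; exists M; split; first exact: num_real.
by move=> x Mx y _; rewrite /= (le_trans (hM y))// ltW.
Qed.

Lemma cvg_char_cos F_ F t : weak_convergence F_ F ->
  char_cos (F_ n) t @[n --> \oo] --> char_cos F t.
Proof.
move=> w; apply: (weak_convergence_sint (M := 1) w); first exact: continuous_cos_mul.
by move=> x; exact: cos_max.
Qed.

Lemma cvg_char_sin F_ F t : weak_convergence F_ F ->
  char_sin (F_ n) t @[n --> \oo] --> char_sin F t.
Proof.
move=> w; apply: (weak_convergence_sint (M := 1) w); first exact: continuous_sin_mul.
by move=> x; exact: sin_max.
Qed.

Lemma char_cos_le1 F t : `|char_cos F t| <= 1.
Proof.
have := @sint_le _ (cdf_pair F) _ 1 (bmf_cos t) (fun x => cos_max _).
by rewrite smass_cdf_pair mulr1.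
Qed.

Lemma char_sin_le1 F t : `|char_sin F t| <= 1.
Proof.
have := @sint_le _ (cdf_pair F) _ 1 (bmf_sin t) (fun x => sin_max _).
by rewrite smass_cdf_pair mulr1.
Qed.

(** For [a >= 0] this is [min (a |x|) 2]; it bounds the change of [cos (t x)] and
[sin (t x)] when [t] moves by at most [a]. *)
Definition damping (a x : R) : R := 2 * clamp (a * `|x| / 2).

Lemma continuous_damping a : continuous (damping a).
Proof.
move=> x; apply: cvgM; first exact: cvg_cst.
apply: (@continuous_comp _ _ _ (fun x => a * `|x| / 2) clamp).
  apply: cvgMl; apply: cvgM; first exact: cvg_cst.
  by apply: cvg_norm; exact: cvg_id.
exact: continuous_clamp.
Qed.

Lemma continuous_damping_param x : continuous (damping^~ x).
Proof.
have cc : continuous (fun a : R => clamp (a * `|x| / 2)).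
  move=> a; apply: (@continuous_comp _ _ _ (fun a : R => a * `|x| / 2) clamp).
    by apply: cvgMl; apply: cvgMl; exact: cvg_id.
  exact: continuous_clamp.
by move=> a; apply: cvgM; [exact: cvg_cst|exact: cc].
Qed.

Lemma damping_le a x : `|damping a x| <= 2.
Proof.
have /andP[c0 c1] := clamp_itv (a * `|x| / 2).
by rewrite /damping normrM (ger0_norm c0) ger0_norm//; lra.
Qed.

Lemma le_damping (a x u v d : R) : `|u - v| <= a -> `|d| <= 2 ->
  `|d| <= `|u * x - v * x| -> `|d| <= damping a x.
Proof.
move=> uva d2 duv; have a0 : 0 <= a := le_trans (normr_ge0 _) uva.
have h : `|d| <= a * `|x|.
  by rewrite (le_trans duv)// -mulrBl normrM ler_wpM2r.
rewrite /damping; have [y1|y1] := leP 1 (a * `|x| / 2).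
  by rewrite clamp_ge1//; lra.
by rewrite clamp_id ?(ltW y1)//; [lra|rewrite divr_ge0// mulr_ge0].
Qed.

(** The difference of two exponentials is dominated by [damping], which tends to
zero with the difference of the arguments.  Being bounded and continuous, it has
small integrals for all large [n] as soon as it has one for the limit. *)
Lemma char_equicontinuous F_ F e : weak_convergence F_ F -> 0 < e ->
  exists2 a : R, 0 < a & \forall n \near \oo, forall s t : R, `|s - t| <= a ->
    `|char_cos (F_ n) s - char_cos (F_ n) t| <= e /\
    `|char_sin (F_ n) s - char_sin (F_ n) t| <= e.
Proof.
move=> w e0; pose a_ k : R := k.+1%:R^-1.
have bd a : bmf (damping a) by exact: (bmf_continuous (@continuous_damping a) (@damping_le a)).
have c0 : sint (cdf_pair F) (damping (a_ k)) @[k --> \oo] --> sint (cdf_pair F) (fun=> 0).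
  apply: (@sint_dct _ _ _ _ 2) => //; first by move=> n x; exact: damping_le.
  move=> x; have -> : (0 : R) = damping 0 x.
    by rewrite /damping !mul0r clamp_le0// mulr0.
  apply: (@cvg_comp _ _ _ a_ (damping^~ x) _ (nbhs (0:R))).
    exact: cvg_harmonic.
  exact: continuous_damping_param.
rewrite sint_cst mul0r in c0.
have [k hk] : exists k, sint (cdf_pair F) (damping (a_ k)) < e.
  have : \forall k \near \oo, sint (cdf_pair F) (damping (a_ k)) < e.
    exact: (cvgr_lt _ c0).
  by case=> k _ kP; exists k; apply: kP => /=.
have cn := weak_convergence_sint w (@continuous_damping (a_ k)) (@damping_le (a_ k)).
exists (a_ k); first by rewrite /a_ invr_gt0.
have : \forall n \near \oo, sint (cdf_pair (F_ n)) (damping (a_ k)) < e.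
  exact: (cvgr_lt _ cn).
apply: filterS => n hn s t st.
have key (f : R -> R) : bmf (fun x => f (s * x)) -> bmf (fun x => f (t * x)) ->
    (forall x, `|f x| <= 1) -> (forall x y, `|f y - f x| <= `|y - x|) ->
    `|sint (cdf_pair (F_ n)) (fun x => f (s * x)) -
      sint (cdf_pair (F_ n)) (fun x => f (t * x))| <= e.
  move=> bs bt f1 flip; rewrite -sintB// (le_trans _ (ltW hn))//.
  rewrite !sint_cdf_pair; pose mu : fmeas := lebesgue_stieltjes_measure (F_ n).
  have bst := bmfB bs bt.
  apply: (le_trans (le_normr_Rintegral measurableT (bmf_integrable mu bst))).
  apply: le_Rintegral => //.
  - have [mf [N fN]] := bst.
    apply: (@bmf_integrable _ mu (fun x => `|f (s * x) - f (t * x)|)); split.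
      exact: measurableT_comp.
    by exists N => x; rewrite normr_id.
  - exact: (bmf_integrable mu (bd (a_ k))).
  - move=> x _; apply: (le_damping st _ (flip _ _)).
    by rewrite (le_trans (ler_normB _ _))// -[2]/(1 + 1) lerD.
split; apply: key.
- exact: bmf_cos.
- exact: bmf_cos.
- exact: cos_max.
- exact: cos_lip.
- exact: bmf_sin.
- exact: bmf_sin.
- exact: sin_max.
- exact: sin_lip.
Qed.

End CharacteristicFunctions.

(** * Logarithms of characteristic functions *)

Section Exponents.
Context {R : realType}.

Lemma norm_le_expR (r d : R) : d <= 2^-1 -> 1 - d <= expR r -> expR r <= 1 + d ->
  `|r| <= 2 * d.
Proof.
move=> d2 h1 h2; have d0 : 0 <= d by lra.
have := expR_ge1Dx r; have h4 := expR_ge1Dx (- r).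
rewrite ler_norml => h3; apply/andP; split; last by lra.
have : expR (- r) * expR r = 1 by rewrite -expRD addNr expR0.
move: h1 h2 h3 h4 (expR_gt0 (- r)).
move: (expR r) (expR (- r)) => a b; nra.
Qed.

(** When [exp (A + i B)] varies little along a segment, the real part does because
the modulus stays away from zero, and the imaginary part because it is
continuous and cannot jump by a multiple of [2 pi]. *)
Lemma exponent_variation (K e : R) : 0 < e -> exists2 d : R, 0 < d &
  forall (A B : R -> R) (s t : R), continuous B -> - K <= A s ->
  (forall u, `|u - s| <= `|t - s| ->
    `|expR (A u) * cos (B u) - expR (A s) * cos (B s)| <= d /\
    `|expR (A u) * sin (B u) - expR (A s) * sin (B s)| <= d) ->
  `|expR (A s) * cos (B s)| <= 1 -> `|expR (A s) * sin (B s)| <= 1 ->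
  `|A t - A s| <= e /\ `|B t - B s| <= e.
Proof.
move=> e0; pose e1 : R := Num.min e 1.
have e1_gt0 : 0 < e1 by rewrite lt_min e0 ltr01.
have e1e : e1 <= e by rewrite ge_min lexx.
have e11 : e1 <= 1 by rewrite ge_min lexx orbT.
have sin1 : 0 < sin e1.
  by apply: sin2_gt0; rewrite e1_gt0 (le_lt_trans e11)// ltr1n.
have sin_le : sin e1 <= e1.
  by have := sin_le_id e1; rewrite !ger0_norm// ltW.
(* expR (A u - A s) is at least 1 - q, hence at least 2/3, but it would be at
   most q / sin e1 = 1/3 at a point u where |B u - B s| = e1 *)
pose q := sin e1 / 3.
have q0 : 0 < q by rewrite divr_gt0.
have q3 : q <= 3^-1 by rewrite /q ler_pdivrMr// mulVf// (le_trans sin_le).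
exists (q / (2 * expR (2 * K))); first by rewrite divr_gt0// mulr_gt0// expR_gt0.
set d := q / _ => A B s t cB AK H C1 S1.
have d0 : 0 < d by rewrite divr_gt0// mulr_gt0// expR_gt0.
have dq : expR (- (2 * A s)) * (2 * d) <= q.
  rewrite (@le_trans _ _ (expR (2 * K) * (2 * d)))//.
    by apply: ler_wpM2r; [rewrite mulr_ge0// ltW|rewrite ler_expR; lra].
  by rewrite /d le_eqVlt; apply/orP; left; apply/eqP; field; rewrite gt_eqF// expR_gt0.
have key u : `|u - s| <= `|t - s| ->
    `|expR (A u - A s) * cos (B u - B s) - 1| <= q /\
    `|expR (A u - A s) * sin (B u - B s)| <= q.
  move=> us; have [hc hs] := H u us.
  have eE : expR (A u - A s) = expR (- (2 * A s)) * (expR (A u) * expR (A s)).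
    by rewrite -!expRD; congr expR; ring.
  have e1E : 1 = expR (- (2 * A s)) * (expR (A s) * expR (A s)) *
     (cos (B s) ^+ 2 + sin (B s) ^+ 2).
    by rewrite cos2Dsin2 mulr1 -!expRD -[LHS]expR0; congr expR; ring.
  have p0 := expR_gt0 (- (2 * A s)).
  split.
  - have -> : expR (A u - A s) * cos (B u - B s) - 1 = expR (- (2 * A s)) *
       ((expR (A u) * cos (B u) - expR (A s) * cos (B s)) * (expR (A s) * cos (B s)) +
        (expR (A u) * sin (B u) - expR (A s) * sin (B s)) * (expR (A s) * sin (B s))).
      by rewrite {1}e1E eE cosB; ring.
    rewrite normrM (gtr0_norm p0) (le_trans _ dq)// ler_pM2l//.
    rewrite (le_trans (ler_normD _ _))//.
    rewrite [X in X + _]normrM [X in _ + X]normrM.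
    have -> : 2 * d = d * 1 + d * 1 by ring.
    by rewrite lerD// ler_pM.
  - have -> : expR (A u - A s) * sin (B u - B s) = expR (- (2 * A s)) *
       ((expR (A u) * sin (B u) - expR (A s) * sin (B s)) * (expR (A s) * cos (B s)) -
        (expR (A u) * cos (B u) - expR (A s) * cos (B s)) * (expR (A s) * sin (B s))).
      by rewrite eE sinB; ring.
    rewrite normrM (gtr0_norm p0) (le_trans _ dq)// ler_pM2l//.
    rewrite (le_trans (ler_normB _ _))//.
    rewrite [X in X + _]normrM [X in _ + X]normrM.
    have -> : 2 * d = d * 1 + d * 1 by ring.
    by rewrite lerD// ler_pM.
split.
- have [X Y] := key t (lexx _).
  set r := A t - A s in X Y *; set th := B t - B s in X Y *.
  have XY : expR r ^+ 2 = (expR r * cos th) ^+ 2 + (expR r * sin th) ^+ 2.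
    by rewrite !exprMn -mulrDr cos2Dsin2 mulr1.
  have r0 := expR_gt0 r.
  have hc := cos_le1 th.
  rewrite (@le_trans _ _ (2 * (q * (3 / 2))))//; last by rewrite /q; lra.
  apply: norm_le_expR; first by lra.
    move: X; rewrite ler_norml => /andP[X _].
    have : expR r * cos th <= expR r by rewrite ler_piMr// ltW.
    by lra.
  rewrite leNgt; apply/negP => h.
  move: X Y XY; rewrite !ler_norml.
  move: (expR r * cos th) (expR r * sin th) => x y /andP[x1 x2] /andP[y1 y2] E.
  have : x ^+ 2 <= (1 + q) ^+ 2 by rewrite ler_sqr ?nnegrE; nra.
  by nra.
- rewrite leNgt; apply/negP => h.
  pose b u : R := `|B u - B s|.
  have cb : continuous b.
    by move=> u; apply: cvg_norm; apply: cvgB; [exact: cB|exact: cvg_cst].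
  have [u us bu] : exists2 u, `|u - s| <= `|t - s| & b u = e1.
    have bs : b s = 0 by rewrite /b subrr normr0.
    have bt : e1 <= b t by rewrite (le_trans e1e)// ltW.
    have [st|ts] := leP s t.
      have [|c] := IVT st (continuous_subspaceT cb) (v := e1).
        by rewrite bs (min_idPl _) ?(max_idPr _) ?bt ?(ltW e1_gt0)// /b normr_ge0.
      rewrite in_itv/= => /andP[sc ct] bc; exists c => //.
      by rewrite !ger0_norm ?subr_ge0// lerD2r.
    have [|c] := IVT (ltW ts) (continuous_subspaceT cb) (v := e1).
      by rewrite bs (min_idPr _) ?(max_idPl _) ?bt ?(ltW e1_gt0)// /b normr_ge0.
    rewrite in_itv/= => /andP[tc cs] bc; exists c => //.
    by rewrite !ler0_norm ?subr_le0 ?(ltW ts)// lerN2 lerD2r.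
  have [X Y] := key u us.
  have sb : `|sin (B u - B s)| = sin e1.
    move: bu; rewrite /b; have [h0|h0] := ltP (B u - B s) 0.
      by rewrite ltr0_norm// => E; rewrite -[B u - B s]opprK E sinN normrN gtr0_norm.
    by rewrite ger0_norm// => ->; rewrite gtr0_norm.
  move: Y; rewrite normrM sb (gtr0_norm (expR_gt0 _)).
  move: X; rewrite ler_norml => /andP[X _].
  have := cos_le1 (B u - B s); have := expR_gt0 (A u - A s).
  have <- : q * 3 = sin e1 by rewrite /q; field.
  move: X; move: (expR _) (cos _) => a c X a0 c1 Y.
  have ac : a * c <= a by rewrite ler_piMr// ltW.
  have : a * 3 <= 1 by rewrite -(ler_pM2l q0); lra.
  lra.
Qed.

End Exponents.

Section ExponentConvergence.
Context {R : realType}.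
Notation cdf := (cumulativeBounded (0 : R) (1 : R)).
Implicit Types (A B : R -> R).

Definition has_exponent (F : cdf) A B : Prop := forall t,
  char_cos F t = expR (A t) * cos (B t) /\ char_sin F t = expR (A t) * sin (B t).

(** A lower bound on the real parts keeps the characteristic functions uniformly
away from zero, so that their equicontinuity passes to their logarithms. *)
Lemma exponent_equicontinuous F_ F (A_ B_ : nat -> R -> R) (L K e : R) :
  weak_convergence F_ F -> (forall n, has_exponent (F_ n) (A_ n) (B_ n)) ->
  (forall n, continuous (B_ n)) -> (forall n s, `|s| <= L -> - K <= A_ n s) ->
  0 < e -> exists2 a : R, 0 < a & \forall n \near \oo, forall s t : R,
    `|s| <= L -> `|t - s| <= a ->
    `|A_ n t - A_ n s| <= e /\ `|B_ n t - B_ n s| <= e.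
Proof.
move=> w FE cB AK e0; have [d d0 dP] := @exponent_variation R K e e0.
have [a a0 aP] := char_equicontinuous w d0.
exists a => //; apply: filterS aP => n nP s t sL ts.
apply: dP => //; first exact: AK.
- move=> u us; have [hu1 hu2] := FE n u; have [hs1 hs2] := FE n s.
  by rewrite -hu1 -hu2 -hs1 -hs2; apply: nP; exact: le_trans ts.
- by have [<- _] := FE n s; exact: char_cos_le1.
- by have [_ <-] := FE n s; exact: char_sin_le1.
Qed.

Lemma weak_convergence_cst (F : cdf) : weak_convergence (fun=> F) F.
Proof. by move=> h _ _; exact: cvg_cst. Qed.

Lemma cvg_of_sub0 (v : nat -> R) (l : R) :
  v n - l @[n --> \oo] --> (0 : R) -> v n @[n --> \oo] --> l.
Proof.
move=> h; have : (v n - l) + l @[n --> \oo] --> 0 + l.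
  by apply: cvgD => //; exact: cvg_cst.
by rewrite add0r; under eq_fun do rewrite subrK.
Qed.

Lemma near_zero_angle (x e : R) : 0 < e -> `|x| <= 1 ->
  1 - cos x < 3 / 8 * e ^+ 2 -> `|x| < e.
Proof.
move=> e0 x1; have := wker_ge x1; rewrite -wkerE => h1 h2.
rewrite -(@ltr_pXn2r _ 2) ?nnegrE ?(ltW e0)//.
rewrite real_normK ?num_real//; have := sqr_ge0 x => x2.
have := ler_wpM2l x2 h1; lra.
Qed.

(** The real parts are logarithms of moduli; the imaginary parts start equal at the origin and, along a grid finer than the
common modulus of continuity, can never differ by a nonzero multiple of
[2 pi]. *)
Lemma exponent_convergence F_ F (A_ B_ : nat -> R -> R) A B (K : R -> R) :
  weak_convergence F_ F -> (forall n, has_exponent (F_ n) (A_ n) (B_ n)) ->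
  has_exponent F A B -> (forall n, continuous (B_ n)) -> continuous B ->
  (forall L n s, `|s| <= L -> - K L <= A_ n s) ->
  (forall L s, `|s| <= L -> - K L <= A s) ->
  (forall n, B_ n 0 = 0) -> B 0 = 0 ->
  forall t, A_ n t @[n --> \oo] --> A t /\ B_ n t @[n --> \oo] --> B t.
Proof.
move=> w FE_ FE cB_ cB AK_ AK B0_ B0.
have hA t : A_ n t @[n --> \oo] --> A t.
  have E A' B' F' : has_exponent F' A' B' ->
      A' t = ln (char_cos F' t ^+ 2 + char_sin F' t ^+ 2) / 2.
    move=> /(_ t)[-> ->]; rewrite !exprMn -mulrDr cos2Dsin2 mulr1.
    by rewrite expr2 -expRD expRK; field.
  rewrite (E _ _ _ FE); under eq_fun do rewrite (E _ _ _ (FE_ _)).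
  have p0 : 0 < char_cos F t ^+ 2 + char_sin F t ^+ 2.
    have [-> ->] := FE t.
    by rewrite !exprMn -mulrDr cos2Dsin2 mulr1 exprn_gt0// expR_gt0.
  have h : char_cos (F_ n) t ^+ 2 + char_sin (F_ n) t ^+ 2 @[n --> \oo]
      --> char_cos F t ^+ 2 + char_sin F t ^+ 2.
    by apply: cvgD; apply: (continuous_cvg _ (@exprn_continuous _ 2 _));
      [exact: cvg_char_cos|exact: cvg_char_sin].
  by apply: cvgMl; exact: (continuous_cvg _ (continuous_ln p0) h).
have hcos u : cos (B_ n u - B u) @[n --> \oo] --> (1 : R).
  have E n : cos (B_ n u - B u) = expR (- A_ n u - A u) *
      (char_cos (F_ n) u * char_cos F u + char_sin (F_ n) u * char_sin F u).
    have [-> ->] := FE_ n u; have [-> ->] := FE u.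
    rewrite cosB; have : expR (- A_ n u - A u) * (expR (A_ n u) * expR (A u)) = 1.
      by rewrite -!expRD -[RHS]expR0; congr expR; ring.
    by move=> h; rewrite -[LHS]mul1r -h; ring.
  under eq_fun do rewrite E.
  have -> : (1 : R) = expR (- A u - A u) *
      (char_cos F u * char_cos F u + char_sin F u * char_sin F u).
    have [-> ->] := FE u.
    have : expR (- A u - A u) * (expR (A u) * expR (A u)) = 1.
      by rewrite -!expRD -[RHS]expR0; congr expR; ring.
    move=> h; rewrite -[LHS]h -[X in _ = _ * X]/(_ * _ + _ * _).
    rewrite (_ : _ + _ = expR (A u) * expR (A u) * (cos (B u) ^+ 2 + sin (B u) ^+ 2)).
      by rewrite cos2Dsin2 mulr1.
    by ring.
  apply: cvgM.
    apply: (continuous_cvg _ (@continuous_expR R _)).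
    by apply: cvgB; [apply: cvgN; exact: hA|exact: cvg_cst].
  by apply: cvgD; (apply: cvgM; last exact: cvg_cst);
    [exact: cvg_char_cos|exact: cvg_char_sin].
move=> t; split; first exact: hA.
(* along the grid, a difference of at most 1/2 becomes at most 1/2 + 1/4 + 1/4,
   and an angle in [-1, 1] is controlled by its cosine *)
have e4 : 0 < 4^-1 :> R by [].
have [a1 a10 a1P] := exponent_equicontinuous w FE_ cB_ (AK_ `|t|) e4.
have [a2 a20 a2P] := exponent_equicontinuous (@weak_convergence_cst F) (fun=> FE)
  (fun=> cB) (fun _ => AK `|t|) e4.
pose a := Num.min a1 a2.
have a0 : 0 < a by rewrite lt_min a10.
pose M := Num.truncn (`|t| / a).
have tM : `|t| / M.+1%:R <= a.
  by rewrite ler_pdivrMr// mulrC -ler_pdivrMr// ltW// truncnS_gt.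
pose u (j : nat) : R := t * (j%:R / M.+1%:R).
have u_le j : (j <= M.+1)%N -> `|u j| <= `|t|.
  move=> jM; rewrite /u normrM ler_piMr// ger0_norm//.
  by rewrite ler_pdivrMr// mul1r ler_nat.
have u_step j : `|u j.+1 - u j| <= a.
  rewrite (_ : _ - _ = t / M.+1%:R) ?normrM ?normfV ?normr_nat//.
  by rewrite /u -natr1; field.
suff H j : (j <= M.+1)%N -> B_ n (u j) - B (u j) @[n --> \oo] --> (0 : R).
  have := H _ (leqnn _); rewrite /u divff// mulr1 => h.
  exact: cvg_of_sub0.
elim: j => [_|j IH jM].
  rewrite /u mul0r mulr0 B0; under eq_fun do rewrite B0_ subr0.
  exact: cvg_cst.
apply/cvgr0Pnorm_lt => e e0.
have e2 : 0 < 3 / 8 * e ^+ 2 by rewrite mulr_gt0// exprn_gt0.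
have half : 0 < 2^-1 :> R by [].
have /cvgr0Pnorm_lt /(_ _ half) hj := IH (ltnW jM).
have /cvgrPdist_lt /(_ _ e2) hc := hcos (u j.+1).
have uL := u_le _ (ltnW jM).
near=> n; apply: near_zero_angle => //.
- have h1 : `|B_ n (u j) - B (u j)| < 2^-1 by near: n.
  have [_ h2] : `|A_ n (u j.+1) - A_ n (u j)| <= 4^-1 /\
      `|B_ n (u j.+1) - B_ n (u j)| <= 4^-1.
    have : forall s t0 : R, `|s| <= `|t| -> `|t0 - s| <= a1 ->
      `|A_ n t0 - A_ n s| <= 4^-1 /\ `|B_ n t0 - B_ n s| <= 4^-1 by near: n.
    by apply => //; rewrite (le_trans (u_step j))// ge_min lexx.
  have [_ h3] : `|A (u j.+1) - A (u j)| <= 4^-1 /\ `|B (u j.+1) - B (u j)| <= 4^-1.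
    have [n0 _ /(_ n0 (leqnn _))] := a2P.
    by apply => //; rewrite (le_trans (u_step j))// ge_min lexx orbT.
  rewrite (_ : B_ n (u j.+1) - B (u j.+1) = (B_ n (u j) - B (u j)) +
    (B_ n (u j.+1) - B_ n (u j)) - (B (u j.+1) - B (u j))); last by ring.
  rewrite (le_trans (ler_normB _ _))//.
  have := ler_normD (B_ n (u j) - B (u j)) (B_ n (u j.+1) - B_ n (u j)).
  by move: h1 h2 h3; lra.
- have : `|1 - cos (B_ n (u j.+1) - B (u j.+1))| < 3 / 8 * e ^+ 2 by near: n.
  by rewrite ger0_norm// one_sub_cos_ge0.
Unshelve. all: by end_near. Qed.

End ExponentConvergence.

(** * Fourier transforms along vague convergence *)

Section BoxAverages.
Context {R : realType}.
Notation T := (measurableTypeR R).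
Notation fmeas := {finite_measure set T -> \bar R}.
Notation leb := (@lebesgue_measure R).

Lemma integral_cos_box (t a x theta : R) : 0 < a ->
  \int[leb]_(s in `[t - a, t + a]) cos (s * x - theta) =
  2 * a * cos (t * x - theta) * (1 + a * x * sker (a * x)).
Proof.
move=> a0; have ta : t - a < t + a by lra.
have E : 2 * a * cos (t * x - theta) * (1 + a * x * sker (a * x)) * x =
    2 * cos (t * x - theta) * sin (a * x).
  have -> : sin (a * x) = (a * x) ^+ 2 * sker (a * x) + a * x by rewrite skerE; ring.
  by ring.
have [x0|x0] := eqVneq x 0.
  subst x.
  under eq_Rintegral do rewrite mulr0.
  rewrite Rintegral_cst//= lebesgue_measure_itv/= lte_fin ta -EFinB/=.
  by rewrite !mulr0 sub0r; ring.
pose f (s : R) : R := cos (s * x - theta).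
pose Fp (s : R) : R := sin (s * x - theta) / x.
have lin (s : R) : is_derive s 1 (fun s => s * x - theta) x.
  rewrite -[X in is_derive _ _ _ X]subr0; apply: is_deriveB.
  have -> : (fun s : R => s * x) = ( *%R x) by apply/funext => z; rewrite mulrC.
  by rewrite -[X in is_derive _ _ _ X]mulr1; exact: is_deriveZ.
have dF (s : R) : is_derive s 1 Fp (f s).
  have h := @is_derive1_comp R sin (fun s : R => s * x - theta) s _ _
    (is_derive_sin _) (lin s).
  have := is_deriveZ x^-1 h.
  rewrite (_ : x^-1 \*: _ = Fp); last by apply/funext => z; rewrite /Fp mulrC.
  by rewrite (_ : x^-1 *: _ = f s)// /GRing.scale/= mulrC mulfK.
have cF : continuous Fp.
  by move=> z; apply/differentiable_continuous/derivable1_diffP; case: (dF z).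
have cf : continuous f.
  move=> z; apply: (continuous_cvg _ (@continuous_cos R _)).
  by apply: cvgB; [apply: cvgMl; exact: cvg_id|exact: cvg_cst].
rewrite /Rintegral (@continuous_FTC2 _ f Fp _ _ ta).
- rewrite -EFinB/=; apply: (mulIf x0); rewrite E /Fp.
  have -> : (t + a) * x - theta = (t * x - theta) + a * x by ring.
  have -> : (t - a) * x - theta = (t * x - theta) - a * x by ring.
  by move: (t * x - theta) => y; rewrite sinD sinB; field.
- exact: continuous_subspaceT.
- split.
  + by move=> z _; case: (dF z).
  + by apply: cvg_at_right_filter; exact: cF.
  + by apply: cvg_at_left_filter; exact: cF.
- by move=> z _; rewrite derive1E; have [_ ->] := dF z.
Qed.

(** For measures that need not be tight, vague convergence does not give
pointwise convergence of Fourier transforms; but it does for their averages over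
boxes, whose kernels vanish at infinity, and equicontinuity removes the
averaging. *)
Lemma fourier_of_vague (m_ : nat -> fmeas * fmeas) m C (v : R -> R) (Mv theta t : R) :
  (forall n, smass (m_ n) <= C) -> vague_convergence m_ m ->
  continuous v -> (forall x, `|v x| <= Mv) ->
  let q mm s := sint mm (fun x => cos (s * x - theta) * v x) in
  (forall e : R, 0 < e -> exists2 a : R, 0 < a & \forall n \near \oo, forall s,
     `|s - t| <= a -> `|q (m_ n) s - q (m_ n) t| <= e) ->
  (forall e : R, 0 < e -> exists2 a : R, 0 < a & forall s,
     `|s - t| <= a -> `|q m s - q m t| <= e) ->
  q (m_ n) t @[n --> \oo] --> q m t.
Proof.
move=> mC vc cv vM q eqn eqm; apply/cvgrPdist_le => e e0.
have e3 : 0 < e / 3 by rewrite divr_gt0.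
have [a1 a10 a1P] := eqn _ e3; have [a2 a20 a2P] := eqm _ e3.
pose a := Num.min a1 a2.
have a0 : 0 < a by rewrite lt_min a10.
have ta : t - a < t + a by lra.
pose I : set R := `[t - a, t + a]%classic.
pose phi : R -> R := \1_I.
have mI : measurable (I : set T) by exact: measurable_itv.
have lI : leb I = (2 * a)%:E.
  by rewrite lebesgue_measure_itv/= lte_fin ta -EFinB; congr (_%:E); ring.
have iphi : leb.-integrable setT (EFin \o phi).
  apply/integrableP; split; first exact/measurable_EFinP/measurable_indic.
  under eq_integral do rewrite /= ger0_norm//.
  by rewrite integral_indic//= setIT lI ltry.
have phiE : \int[leb]_s phi s = 2 * a.
  by rewrite /Rintegral integral_indic//= setIT lI.
pose k (s x : R) : R := cos (s * x - theta) * v x.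
have mk : measurable_fun [set: T * T] (fun z : T * T => k z.1 z.2).
  apply: measurable_funM; last first.
    by apply: (measurableT_comp (continuous_measurable_fun cv)); exact: measurable_snd.
  apply: (measurableT_comp (continuous_measurable_fun (@continuous_cos R))).
  apply: measurable_funB; last exact: measurable_cst.
  by apply: measurable_funM; [exact: measurable_fst|exact: measurable_snd].
have kM s x : `|k s x| <= Mv.
  by rewrite normrM -[leRHS]mul1r ler_pM// cos_max.
have mixE : mixture phi k = (fun x =>
    2 * a * cos (t * x - theta) * (1 + a * x * sker (a * x)) * v x).
  apply/funext => x; rewrite /mixture -integral_cos_box// -RintegralZr//.
    rewrite [RHS]Rintegral_mkcond; apply: eq_Rintegral => s _.
    by rewrite /phi indicE patchE /k; case: (_ \in _); rewrite ?mul1r ?mul0r.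
  apply: continuous_compact_integrable; first exact: segment_compact.
  apply: continuous_subspaceT => s.
  apply: (continuous_cvg _ (@continuous_cos R _)).
  by apply: cvgB; [apply: cvgMl; exact: cvg_id|exact: cvg_cst].
have bmix := bmf_mixture iphi mk kM.
have cmix : sint (m_ n) (mixture phi k) @[n --> \oo] --> sint m (mixture phi k).
  apply: (vague_convergence_vanishing mC vc bmix).
    rewrite mixE => x; apply: cvgM; last exact: cv.
    apply: cvgM.
      apply: cvgM; first exact: cvg_cst.
      apply: (continuous_cvg _ (@continuous_cos R _)).
      by apply: cvgB; [apply: cvgM; [exact: cvg_cst|exact: cvg_id]|exact: cvg_cst].
    apply: cvgD; first exact: cvg_cst.
    have cax : a * y @[y --> x] --> a * x.
      by apply: cvgM; [exact: cvg_cst|exact: cvg_id].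
    by apply: cvgM => //; exact: (continuous_cvg _ (@continuous_sker R _)).
  move=> d d0; exists (2 * Mv / d) => x xd.
  have M0 : 0 <= Mv := le_trans (normr_ge0 _) (vM 0).
  have x0 : 0 < `|x| by rewrite (le_lt_trans _ xd)// divr_ge0 ?mulr_ge0// ltW.
  rewrite mixE -(ler_pM2r x0) -normrM.
  rewrite (_ : 2 * a * cos (t * x - theta) * (1 + a * x * sker (a * x)) * v x * x
    = (2 * cos (t * x - theta)) * sin (a * x) * v x); last first.
    have -> : sin (a * x) = (a * x) ^+ 2 * sker (a * x) + a * x by rewrite skerE; ring.
    by ring.
  rewrite (@le_trans _ _ (2 * Mv))//; last by rewrite [leRHS]mulrC -ler_pdivrMr// ltW.
  rewrite !normrM ler_pM ?mulr_ge0// ger0_norm// -mulrA ler_piMr//.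
  by rewrite mulr_ile1 ?cos_max ?sin_max.
have avg mm : (forall s, `|s - t| <= a -> `|q mm s - q mm t| <= e / 3) ->
    `|sint mm (mixture phi k) - 2 * a * q mm t| <= 2 * a * (e / 3).
  move=> h; rewrite (sint_mixture iphi mk kM) -phiE -!RintegralZr//.
  have i1 := integrable_mixed iphi mk kM mm.
  have i2 : leb.-integrable setT (EFin \o (fun s => phi s * q mm t)).
    exact: (integrableZr measurableT (q mm t) iphi).
  have i3 : leb.-integrable setT (EFin \o (fun s => phi s * (e / 3))).
    exact: (integrableZr measurableT (e / 3) iphi).
  rewrite -RintegralB//; have i12 := integrableB measurableT i1 i2.
  apply: (le_trans (le_normr_Rintegral measurableT i12)).
  apply: le_Rintegral => //; first exact: (integrable_norm i12).
  move=> s _; rewrite /phi indicE; have [|_] := boolP (_ \in _); last first.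
    by rewrite !mul0r subrr normr0.
  rewrite inE /I/= in_itv/= => /andP[s1 s2]; rewrite !mul1r; apply: h.
  by rewrite ler_norml; apply/andP; split; lra.
have hm : `|sint m (mixture phi k) - 2 * a * q m t| <= 2 * a * (e / 3).
  by apply: avg => s sa; apply: a2P; rewrite (le_trans sa)// ge_min lexx orbT.
have a2e : 0 < 2 * a * (e / 3) by rewrite !mulr_gt0.
have aa : 0 < 2 * a by rewrite mulr_gt0.
move/cvgrPdist_le : cmix => /(_ _ a2e) hc.
near=> n.
have hn : `|sint (m_ n) (mixture phi k) - 2 * a * q (m_ n) t| <= 2 * a * (e / 3).
  apply: avg; have : forall s, `|s - t| <= a1 -> `|q (m_ n) s - q (m_ n) t| <= e / 3.
    by near: n.
  by move=> h s sa; apply: h; rewrite (le_trans sa)// ge_min lexx.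
have hmn : `|sint m (mixture phi k) - sint (m_ n) (mixture phi k)| <= 2 * a * (e / 3).
  by near: n.
rewrite -(ler_pM2l aa) -{1}(gtr0_norm aa) -normrM.
rewrite (_ : 2 * a * (q m t - q (m_ n) t) =
  (sint m (mixture phi k) - sint (m_ n) (mixture phi k))
  - (sint m (mixture phi k) - 2 * a * q m t)
  + (sint (m_ n) (mixture phi k) - 2 * a * q (m_ n) t)); last by ring.
rewrite (le_trans (ler_normD _ _))//.
have := ler_normB (sint m (mixture phi k) - sint (m_ n) (mixture phi k))
  (sint m (mixture phi k) - 2 * a * q m t).
by move: hn hmn hm; lra.
Unshelve. all: by end_near. Qed.

End BoxAverages.

(** * Weak convergence and spectral data *)

Section WeakConvergenceAndSpectra.
Context {R : realType}.
Notation T := (measurableTypeR R).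
Notation fmeas := {finite_measure set T -> \bar R}.
Notation cdf := (cumulativeBounded (0 : R) (1 : R)).

(** The existence of some weak limit supplies tightness; what remains is to
identify two probability measures, by their integrals of functions of compact
support, to which the Fourier criterion applies. *)
Lemma weak_convergence_of_char (F_ : nat -> cdf) (F0 F : cdf) :
  weak_convergence F_ F0 ->
  (forall t, char_cos (F_ n) t @[n --> \oo] --> char_cos F t) ->
  (forall t, char_sin (F_ n) t @[n --> \oo] --> char_sin F t) ->
  weak_convergence F_ F.
Proof.
move=> w hc hs h ch bh; rewrite -(sint_cdf_pair F h).
suff <- : sint (cdf_pair F0) h = sint (cdf_pair F) h.
  by rewrite sint_cdf_pair; exact: w.
have [M hM] : exists M, forall x, `|h x| <= M.
  have [N [_ NP]] := bh; exists (N + 1) => x.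
  by apply: (NP (N + 1)); rewrite ?ltrDl.
have mC n : smass (cdf_pair (F_ n)) <= 1 by rewrite smass_cdf_pair.
have cc N : sint (cdf_pair F0) (fun x => cutoff N x * h x) =
    sint (cdf_pair F) (fun x => cutoff N x * h x).
  have cs := compactly_supported_cutoff N ch.
  have [M' hM'] := compactly_supported_bounded cs.
  have h1 := weak_convergence_sint w cs.1 hM'.
  suff h2 : sint (cdf_pair (F_ n)) (fun x => cutoff N x * h x) @[n --> \oo]
      --> sint (cdf_pair F) (fun x => cutoff N x * h x).
    exact: (cvg_unique _ h1 h2).
  have E (f : R -> R) : (fun x => f x * (1 : R)) = f by apply/funext => x; rewrite mulr1.
  have := @cvg_sint_compact _ (fun n => cdf_pair (F_ n)) (cdf_pair F) 1
    (fun=> 1) _ _ mC (bmf_cst 1) cs.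
  rewrite !E.
  by apply => t; rewrite (E (fun x => _)); [exact: hc|exact: hs].
have lim0 (F' : cdf) : sint (cdf_pair F') (fun x => cutoff n%:R x * h x) @[n --> \oo]
    --> sint (cdf_pair F') h.
  apply: (@sint_dct _ _ _ _ M).
  - by move=> n; exact: compactly_supported_bmf (compactly_supported_cutoff _ ch).
  - move=> n x; have /andP[c0 c1] := clamp_itv (n%:R + 1 - `|x|).
    by rewrite normrM (le_trans _ (hM x))// ler_piMl// ger0_norm.
  - move=> x; apply: cvg_near_cst; near=> n.
    rewrite cutoff_in ?mul1r// (@le_trans _ _ (Num.truncn `|x|).+1%:R)//.
      by rewrite ltW// truncnS_gt.
    by rewrite ler_nat; near: n; exact: nbhs_infty_ge.
have := lim0 F0; under eq_fun do rewrite cc.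
by move=> /cvg_unique; apply => //; exact: lim0.
Unshelve. all: by end_near. Qed.

Variables (tau : R) (F_ : nat -> cdf) (m_ : nat -> fmeas * fmeas)
  (gamma_ : nat -> R) (F : cdf) (m : fmeas * fmeas) (gamma C : R).
Hypotheses (tau0 : 0 < tau) (mC_ : forall n, smass (m_ n) <= C)
  (mC : smass m <= C).
Let A_ n := expo_re (m_ n).
Let B_ n := expo_im tau (m_ n) (gamma_ n).
Let A := expo_re m.
Let B := expo_im tau m gamma.
Hypotheses (FE_ : forall n, has_exponent (F_ n) (A_ n) (B_ n))
  (FE : has_exponent F A B).

Let K (L : R) := (L ^+ 2 + 4) * C.

Let AK_ L n s : `|s| <= L -> - K L <= A_ n s.
Proof. exact: expo_re_ge. Qed.

Let AK L s : `|s| <= L -> - K L <= A s.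
Proof. exact: expo_re_ge. Qed.

Let cB_ n : continuous (B_ n).
Proof. exact: continuous_expo_im. Qed.

Let cB : continuous B.
Proof. exact: continuous_expo_im. Qed.

(** Weak convergence passes to the exponents.  Their values at [tau] give the
drifts, and their second differences are, up to sign, the Fourier transforms of
the weighted measures. *)
Lemma spectra_of_weak_convergence : weak_convergence F_ F ->
  [/\ gamma_ n @[n --> \oo] --> gamma, vague_convergence m_ m &
      sint (m_ n) (fun=> 1) @[n --> \oo] --> sint m (fun=> 1)].
Proof.
move=> w.
have AB := exponent_convergence w FE_ FE cB_ cB AK_ AK
  (fun n => expo_im0 tau (m_ n) (gamma_ n)) (expo_im0 tau m gamma).
have hg : gamma_ n @[n --> \oo] --> gamma.
  apply: (cvg_scale_inv (lt0r_neq0 tau0)).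
  rewrite -(expo_im_tau tau0 m gamma).
  under eq_fun => n do rewrite -(expo_im_tau tau0 (m_ n)).
  exact: (AB tau).2.
have hc h t : sint (m_ n) (fun x => cos (t * x) * levy_weight h x)
     @[n --> \oo] --> sint m (fun x => cos (t * x) * levy_weight h x).
  rewrite -[X in _ --> X]opprK -expo_re_diff2.
  under eq_fun do rewrite -[sint _ _]opprK -expo_re_diff2.
  apply: cvgN; apply: cvgB; first by apply: cvgD; exact: (AB _).1.
  by apply: cvgM; [exact: cvg_cst|exact: (AB _).1].
have hs h t : sint (m_ n) (fun x => sin (t * x) * levy_weight h x)
     @[n --> \oo] --> sint m (fun x => sin (t * x) * levy_weight h x).
  rewrite -[X in _ --> X]opprK -(expo_im_diff2 tau0 m gamma).
  under eq_fun => n do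
    rewrite -[sint _ _]opprK -(expo_im_diff2 tau0 (m_ n) (gamma_ n)).
  apply: cvgN; apply: cvgB; first by apply: cvgD; exact: (AB _).2.
  by apply: cvgM; [exact: cvg_cst|exact: (AB _).2].
have vc := vague_convergence_fourier mC_ hc hs.
split => //; apply: (cvg_total_mass mC_ vc) => h.
have E : levy_weight h = (fun x => cos (0 * x) * levy_weight h x).
  by apply/funext => x; rewrite mul0r cos0 mul1r.
by rewrite E; exact: hc.
Qed.

(** Vague convergence yields the convergence of the second differences of the
exponents, because these are equicontinuous.  The real part of the exponent is
itself half a second difference at the origin.  The difference [D n] of the
imaginary parts vanishes at the origin and is thus asymptotically additive along
multiples of any point; convergence at [tau], which is that of the drifts, then
gives convergence at the rational multiples of [tau], and equicontinuity gives
the rest.  Hence the characteristic functions converge, and the weak limit at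
hand is [F]. *)
Lemma weak_convergence_of_spectra (F0 : cdf) : weak_convergence F_ F0 ->
  gamma_ n @[n --> \oo] --> gamma -> vague_convergence m_ m ->
  weak_convergence F_ F.
Proof.
move=> w hg vc.
have eq_ L e : 0 < e -> exists2 a : R, 0 < a & \forall n \near \oo, forall s t : R,
    `|s| <= L -> `|t - s| <= a ->
    `|A_ n t - A_ n s| <= e /\ `|B_ n t - B_ n s| <= e.
  by move=> e0; exact: (exponent_equicontinuous w FE_ cB_ (@AK_ L) e0).
have eq0 L e : 0 < e -> exists2 a : R, 0 < a & forall s t : R,
    `|s| <= L -> `|t - s| <= a -> `|A t - A s| <= e /\ `|B t - B s| <= e.
  move=> e0; have [a a0 [n _ /(_ n (leqnn _)) h]] := exponent_equicontinuous
    (@weak_convergence_cst _ F) (fun=> FE) (fun=> cB) (fun _ => @AK L) e0.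
  by exists a.
(* theta = 0 selects the cosine transform and theta = pi / 2 the sine one *)
pose q theta h (mm : fmeas * fmeas) s :=
  sint mm (fun x => cos (s * x - theta) * levy_weight h x).
have qE theta h mm g s : q theta h mm s =
   - (cos theta * (expo_re mm (s + h) + expo_re mm (s - h) - 2 * expo_re mm s) +
      sin theta * (expo_im tau mm g (s + h) + expo_im tau mm g (s - h)
         - 2 * expo_im tau mm g s)).
  rewrite expo_re_diff2 expo_im_diff2// !mulrN -opprD opprK.
  have b1 : bmf (fun x => cos (s * x) * levy_weight h x).
    by apply: bmfM; [exact: bmf_cos|exact: bmf_levy_weight].
  have b2 : bmf (fun x => sin (s * x) * levy_weight h x).
    by apply: bmfM; [exact: bmf_sin|exact: bmf_levy_weight].
  rewrite -sintZ// -sintZ// -sintD; try exact: bmfZ.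
  by congr sint; apply/funext => x; rewrite cosB; ring.
(* the coefficients of a second difference have absolute values of sum 4, and
   there are two of them; hence e / 8 *)
have q_lip theta h t e (A' B' : R -> R) (s : R) :
    `|A' (s + h) - A' (t + h)| <= e / 8 /\ `|B' (s + h) - B' (t + h)| <= e / 8 ->
    `|A' (s - h) - A' (t - h)| <= e / 8 /\ `|B' (s - h) - B' (t - h)| <= e / 8 ->
    `|A' s - A' t| <= e / 8 /\ `|B' s - B' t| <= e / 8 ->
    `|- (cos theta * (A' (s + h) + A' (s - h) - 2 * A' s) +
      sin theta * (B' (s + h) + B' (s - h) - 2 * B' s)) -
     - (cos theta * (A' (t + h) + A' (t - h) - 2 * A' t) +
      sin theta * (B' (t + h) + B' (t - h) - 2 * B' t))| <= e.
  move=> [a1 b1] [a2 b2] [a3 b3].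
  rewrite (_ : _ - _ = - (cos theta * ((A' (s + h) - A' (t + h)) +
     (A' (s - h) - A' (t - h)) - 2 * (A' s - A' t)) +
     sin theta * ((B' (s + h) - B' (t + h)) +
     (B' (s - h) - B' (t - h)) - 2 * (B' s - B' t)))); last by ring.
  rewrite normrN (le_trans (ler_normD _ _))// !normrM.
  have bound (x y z : R) : `|x| <= e / 8 -> `|y| <= e / 8 -> `|z| <= e / 8 ->
      `|x + y - 2 * z| <= e / 2.
    by rewrite !ler_norml => /andP[? ?] /andP[? ?] /andP[? ?]; apply/andP; split; lra.
  have -> : e = 1 * (e / 2) + 1 * (e / 2) by field.
  by rewrite lerD// ler_pM// ?cos_max ?sin_max// bound.
have qcvg theta h t : q theta h (m_ n) t @[n --> \oo] --> q theta h m t.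
  have thL : `|t + h| <= `|t| + `|h| by exact: ler_normD.
  have tmL : `|t - h| <= `|t| + `|h| by exact: ler_normB.
  have tL : `|t| <= `|t| + `|h| by rewrite lerDl.
  have sh s : (s + h) - (t + h) = s - t by ring.
  have shN s : (s - h) - (t - h) = s - t by ring.
  apply: (fourier_of_vague mC_ vc (@continuous_levy_weight _ h) (levy_weight_le h)).
  - move=> e e0; have e8 : 0 < e / 8 by rewrite divr_gt0.
    have [a a0 aP] := eq_ (`|t| + `|h|) _ e8; exists a => //.
    apply: filterS aP => n nP s st; rewrite -!/(q _ _ _ _) !(qE _ _ _ (gamma_ n)).
    by apply: q_lip; apply: nP; rewrite ?sh ?shN.
  - move=> e e0; have e8 : 0 < e / 8 by rewrite divr_gt0.
    have [a a0 aP] := eq0 (`|t| + `|h|) _ e8; exists a => //.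
    move=> s st; rewrite -!/(q _ _ _ _) !(qE _ _ _ gamma).
    by apply: q_lip; apply: aP; rewrite ?sh ?shN.
have hA t : A_ n t @[n --> \oo] --> A t.
  have E mm : expo_re mm t = - 2^-1 * q 0 t mm 0.
    rewrite /expo_re sint_levy_re; congr (_ * sint _ _); apply/funext => x.
    by rewrite mul0r subr0 cos0 mul1r.
  rewrite /A E /A_; under eq_fun do rewrite E.
  by apply: cvgM; [exact: cvg_cst|exact: qcvg].
pose D n t := B_ n t - B t.
have D2 t h : D n (t + h) + D n (t - h) - 2 * D n t @[n --> \oo] --> (0 : R).
  have E n : D n (t + h) + D n (t - h) - 2 * D n t =
      q (pi / 2) h m t - q (pi / 2) h (m_ n) t.
    rewrite (qE _ _ _ gamma) (qE _ _ _ (gamma_ n)) cos_pihalf sin_pihalf.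
    by rewrite /D /B_ /B; ring.
  under eq_fun do rewrite E.
  rewrite -(subrr (q (pi / 2) h m t)).
  by apply: cvgB; [exact: cvg_cst|exact: qcvg].
have D0 n : D n 0 = 0 by rewrite /D /B_ /B !expo_im0 subrr.
have Dk t k : D n (k%:R * t) - k%:R * D n t @[n --> \oo] --> (0 : R) /\
    D n (k.+1%:R * t) - k.+1%:R * D n t @[n --> \oo] --> (0 : R).
  elim: k => [|k [IH1 IH2]].
    split; first by under eq_fun do rewrite !mul0r D0 subrr; exact: cvg_cst.
    by under eq_fun do rewrite !mul1r subrr; exact: cvg_cst.
  split => //.
  have E n : D n (k.+2%:R * t) - k.+2%:R * D n t =
     (D n (k.+1%:R * t + t) + D n (k.+1%:R * t - t) - 2 * D n (k.+1%:R * t)) +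
     2 * (D n (k.+1%:R * t) - k.+1%:R * D n t) - (D n (k%:R * t) - k%:R * D n t).
    have -> : k.+2%:R * t = k.+1%:R * t + t by rewrite -[k.+2%:R]natr1; ring.
    have -> : k.+1%:R * t - t = k%:R * t by rewrite -natr1; ring.
    by rewrite -!natr1; ring.
  rewrite (_ : (0 : R) = 0 + 2 * 0 - 0); last by ring.
  under eq_fun do rewrite E.
  apply: cvgB => //; apply: cvgD; first exact: D2.
  by apply: cvgM => //; exact: cvg_cst.
have Dtau : D n tau @[n --> \oo] --> (0 : R).
  rewrite /D /B_ /B; under eq_fun do rewrite !expo_im_tau// -mulrBr.
  rewrite -(mulr0 tau) -(subrr gamma).
  by apply: cvgM; [exact: cvg_cst|apply: cvgB => //; exact: cvg_cst].
have DM M k : D n (k%:R * (tau / M.+1%:R)) @[n --> \oo] --> (0 : R).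
  have h1 : D n (tau / M.+1%:R) @[n --> \oo] --> (0 : R).
    have M0 : M.+1%:R != 0 :> R by rewrite pnatr_eq0.
    apply: (cvg_scale_inv M0); rewrite mulr0.
    have E n : M.+1%:R * D n (tau / M.+1%:R) = D n tau -
        (D n (M.+1%:R * (tau / M.+1%:R)) - M.+1%:R * D n (tau / M.+1%:R)).
      have -> : M.+1%:R * (tau / M.+1%:R) = tau by rewrite mulrC divfK.
      by ring.
    under eq_fun do rewrite E.
    by rewrite -(subrr (0 : R)); apply: cvgB => //; exact: (Dk _ M).2.
  have E n : D n (k%:R * (tau / M.+1%:R)) =
     (D n (k%:R * (tau / M.+1%:R)) - k%:R * D n (tau / M.+1%:R))
     + k%:R * D n (tau / M.+1%:R) by ring.
  rewrite (_ : (0 : R) = 0 + k%:R * 0); last by ring.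
  under eq_fun do rewrite E.
  by apply: cvgD; [exact: (Dk _ k).1|apply: cvgM => //; exact: cvg_cst].
have Dpos t : 0 <= t -> D n t @[n --> \oo] --> (0 : R).
  move=> t0; apply/cvgr0Pnorm_lt => e e0.
  have e4 : 0 < e / 4 by rewrite divr_gt0.
  have [a1 a10 a1P] := eq_ `|t| _ e4; have [a2 a20 a2P] := eq0 `|t| _ e4.
  pose a := Num.min a1 a2.
  have a0 : 0 < a by rewrite lt_min a10.
  pose M := Num.truncn (tau / a); pose d := tau / M.+1%:R.
  have d0 : 0 < d by rewrite divr_gt0.
  have da : d <= a.
    by rewrite /d ler_pdivrMr// mulrC -ler_pdivrMr// ltW// truncnS_gt.
  pose k := Num.truncn (t / d).
  have kt : `|k%:R * d - t| <= a.
    have h1 : k%:R * d <= t.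
      by rewrite -ler_pdivlMr// Num.Theory.truncn_le// divr_ge0// ltW.
    have h2 : t <= k%:R * d + d.
      have -> : k%:R * d + d = k.+1%:R * d by rewrite -natr1; ring.
      by rewrite -ler_pdivrMr// ltW// truncnS_gt.
    by rewrite ler0_norm; lra.
  have /cvgr0Pnorm_lt /(_ _ e4) hk := DM M k.
  near=> n.
  have h1 : `|D n (k%:R * d)| < e / 4 by near: n.
  have [_ h2] : `|A_ n (k%:R * d) - A_ n t| <= e / 4 /\
      `|B_ n (k%:R * d) - B_ n t| <= e / 4.
    have : forall s t0 : R, `|s| <= `|t| -> `|t0 - s| <= a1 ->
      `|A_ n t0 - A_ n s| <= e / 4 /\ `|B_ n t0 - B_ n s| <= e / 4 by near: n.
    by apply => //; rewrite (le_trans kt)// ge_min lexx.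
  have [_ h3] : `|A (k%:R * d) - A t| <= e / 4 /\ `|B (k%:R * d) - B t| <= e / 4.
    by apply: a2P => //; rewrite (le_trans kt)// ge_min lexx orbT.
  rewrite (_ : D n t = D n (k%:R * d) - (B_ n (k%:R * d) - B_ n t)
     + (B (k%:R * d) - B t)); last by rewrite /D; ring.
  rewrite (le_lt_trans (ler_normD _ _))//.
  have := ler_normB (D n (k%:R * d)) (B_ n (k%:R * d) - B_ n t).
  by move: h1 h2 h3 e0; lra.
have hB t : B_ n t @[n --> \oo] --> B t.
  apply: cvg_of_sub0; have [t0|/ltW t0] := leP 0 t; first exact: Dpos.
  have E n : B_ n t - B t = - D n (- t) by rewrite /D /B_ /B !expo_imN//; ring.
  under eq_fun do rewrite E.
  by rewrite -oppr0; apply: cvgN; apply: Dpos; rewrite oppr_ge0.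
apply: (weak_convergence_of_char w) => t.
- have [-> _] := FE t; under eq_fun do rewrite (FE_ _ t).1.
  apply: cvgM; first exact: (continuous_cvg _ (@continuous_expR R _)).
  exact: (continuous_cvg _ (@continuous_cos R _)).
- have [_ ->] := FE t; under eq_fun do rewrite (FE_ _ t).2.
  apply: cvgM; first exact: (continuous_cvg _ (@continuous_expR R _)).
  exact: (continuous_cvg _ (@continuous_sin R _)).
Unshelve. all: by end_near. Qed.

End WeakConvergenceAndSpectra.

(** * From spectral pairs to pairs of measures *)

Section SpectralPairs.
Context {R : realType}.
Notation T := (measurableTypeR R).
Notation fmeas := {finite_measure set T -> \bar R}.
Notation cdf := (cumulativeBounded (0 : R) (1 : R)).
Implicit Types (G : R -> R) (F : cdf) (m : fmeas * fmeas).

Definition charge_pair (nu : {charge set T -> \bar R}) : fmeas * fmeas :=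
  let P_ := cid (Hahn_decomposition nu) in
  let N_ := cid (projT2 P_) in
  (jordan_pos (projT2 N_) : fmeas, jordan_neg (projT2 N_) : fmeas).

Lemma charge_RintegralE (nu : {charge set T -> \bar R}) h :
  charge_Rintegral nu h = sint (charge_pair nu) h.
Proof. by []. Qed.

Lemma smass_charge_pair_le nu G : classV G -> is_stieltjes_charge G nu ->
  smass (charge_pair nu) <= fine (total_variationR G).
Proof. by move=> VG nuG; exact: jordan_mass_le. Qed.

Lemma stieltjes_charge_pair nu G :
  is_stieltjes_charge G nu -> stieltjes_pair (charge_pair nu) G.
Proof.
move=> nuG a b ab; rewrite sint_indic//.
apply: EFin_inj; rewrite -(nuG _ _ ab) /charge_pair/=.
rewrite (jordan_decomp (svalP (cid (svalP (cid (Hahn_decomposition nu)))))) //.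
by rewrite /cadd/= cscaleN1 EFinB !fineK ?fin_num_measure//; exact: measurable_itv.
Qed.

Lemma cexp_imag (u : R) : cexp ('i%C * (u%:C)%C) = (cos u +i* sin u)%C.
Proof.
rewrite /cexp /=.
rewrite !(mul0r, mul1r, mulr0, subr0, addr0, add0r, oppr0) expR0.
by rewrite mul1r.
Qed.

(** The value at the origin agrees with the continuous extension. *)
Lemma levy_integrandE (tau t x : R) : 0 < tau ->
  levy_integrand tau t x = (levy_re t x +i* levy_im tau t x)%C :> R[i]%C.
Proof.
move=> tau0; rewrite /levy_integrand; case: eqVneq => [->|x0].
  by rewrite levy_re0 levy_im0.
rewrite levy_reE// levy_imE// cexp_imag.
apply/eqP; rewrite eq_complex /=; apply/andP; split; apply/eqP; ring.
Qed.

Lemma has_exponent_charge_pair (tau : R) F gamma nu : 0 < tau ->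
  (forall t : R, char_fun F t =
      cexp ('i%C * ((t * gamma)%:C)%C
            + cintegral (charge_Rintegral nu) (levy_integrand tau t))) ->
  has_exponent F (expo_re (charge_pair nu)) (expo_im tau (charge_pair nu) gamma).
Proof.
move=> tau0 H t; have := H t; rewrite /char_fun /cintegral !charge_RintegralE.
have -> : (fun x => complex.Re (levy_integrand tau t x)) = levy_re t.
  by apply/funext => x; rewrite levy_integrandE.
have -> : (fun x => complex.Im (levy_integrand tau t x)) = levy_im tau t.
  by apply/funext => x; rewrite levy_integrandE.
have -> : (fun x => complex.Re (cexp ('i%C * ((t * x)%:C)%C))) = (fun x => cos (t * x)).
  by apply/funext => x; rewrite cexp_imag.
have -> : (fun x => complex.Im (cexp ('i%C * ((t * x)%:C)%C))) = (fun x => sin (t * x)).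
  by apply/funext => x; rewrite cexp_imag.
rewrite -!sint_cdf_pair /cexp /=.
rewrite !(mul0r, mul1r, mulr0, subr0, addr0, add0r) => -[cosE sinE].
by move: cosE sinE; rewrite !mul0r !oppr0 !addr0 !add0r.
Qed.

Lemma spectral_pair_data (tau : R) F gamma G : 0 < tau -> spectral_pair tau F gamma G ->
  exists m, [/\ stieltjes_pair m G, smass m <= fine (total_variationR G) &
    has_exponent F (expo_re m) (expo_im tau m gamma)].
Proof.
move=> tau0 [VG [nu nuG H]]; exists (charge_pair nu); split.
- exact: stieltjes_charge_pair.
- exact: smass_charge_pair_le.
- exact: has_exponent_charge_pair.
Qed.

(** As [G] vanishes at [-oo], its value at a large [u] is asymptotically the mass
of the interval from [- u] to [u]. *)
Lemma limit_pinftyE m G : stieltjes_pair m G -> G x @[x --> -oo] --> 0 ->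
  limit_pinfty G = sint m (fun=> 1).
Proof.
move=> mG G0; apply/cvg_lim; first exact: norm_hausdorff.
apply/cvg_pinftyP => u uoo.
have i1 : sint m \1_(`]- u n, u n]) @[n --> \oo] --> sint m (fun=> 1).
  apply: (@sint_dct _ _ _ _ 1).
  - by move=> n; apply: bmf_indic; exact: measurable_itv.
  - by move=> n x; rewrite indic_itvoc; case: (_ && _); rewrite ?normr1 ?normr0.
  - move=> x; apply: cvg_near_cst; near=> n.
    rewrite indic_itvoc (_ : - u n < x); last first.
      by rewrite ltrNl; near: n; exact: cvgry_gt.
    by rewrite (_ : x <= u n)//; near: n; exact: cvgry_ge.
have i2 : G (- u n) @[n --> \oo] --> 0.
  have /cvgNy_compNP /cvg_pinftyP := G0.
  by move=> /(_ _ uoo).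
rewrite -[X in _ --> X]addr0.
apply: cvg_trans (cvgD i1 i2); apply: near_eq_cvg; near=> n.
rewrite -[LHS]/(sint m \1_(`]- u n, u n]) + G (- u n)) -mG ?subrK//.
have un : 0 <= u n by near: n; exact: cvgry_ge.
by rewrite (le_trans _ un)// oppr_le0.
Unshelve. all: by end_near. Qed.

Lemma limn_esup_bounded (v : nat -> \bar R) :
  (limn_esup v < +oo)%E -> (forall n, (v n < +oo)%E) ->
  exists C, forall n, fine (v n) <= C.
Proof.
move=> vlim vfin; have [_ [A [N _ NA] <-]] := ereal_inf_lt vlim.
move=> sA.
exists (\sum_(k < N) `|fine (v k)| + `|fine (ereal_sup [set v x | x in A])|) => n.
have [nN|Nn] := ltnP n N.
  rewrite ler_wpDr// (bigD1 (Ordinal nN))//= (le_trans (ler_norm _))// lerDl.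
  exact: sumr_ge0.
rewrite ler_wpDl ?sumr_ge0//.
have vA : (v n <= ereal_sup [set v x | x in A])%E.
  by apply: ereal_sup_ubound; exists n => //; exact: NA.
move: vA sA (vfin n); case: (ereal_sup _) => [s| |]//; case: (v n) => //= r rs _ _.
by rewrite (le_trans _ (ler_norm _)).
Qed.

Lemma cvg_of_subsequences (u : nat -> R) (l : R) :
  (forall phi : nat -> nat, increasing_seq phi ->
     exists2 psi : nat -> nat, increasing_seq psi &
       u (phi (psi k)) @[k --> \oo] --> l) ->
  u n @[n --> \oo] --> l.
Proof.
move=> H; apply: contrapT => /cvgrPdist_lt.
move=> /existsNP[e /not_implyP[e0 nfar]].
have far n : exists k, (n <= k)%N /\ e <= `|l - u k|.
  apply: contrapT => h; apply: nfar; exists n => // k /= nk.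
  by rewrite ltNge; apply/negP => ek; apply: h; exists k.
pose next n := projT1 (cid (far n)).
have next_ge n : (n <= next n)%N by exact: (projT2 (cid (far n))).1.
have next_far n : e <= `|l - u (next n)| by exact: (projT2 (cid (far n))).2.
pose fix phi n := if n is k.+1 then next (phi k).+1 else next 0%N.
have phi_far n : e <= `|l - u (phi n)| by case: n => *; exact: next_far.
have iphi : increasing_seq phi.
  by apply/increasing_seqP => n; exact: next_ge.
have [psi _ /cvgrPdist_lt /(_ _ e0)[k _ /(_ k (leqnn _))]] := H _ iphi.
by rewrite ltNge phi_far.
Qed.

Lemma increasing_seq_comp (phi psi : nat -> nat) :
  increasing_seq phi -> increasing_seq psi -> increasing_seq (fun k => phi (psi k)).
Proof. by move=> iphi ipsi a b; rewrite /= iphi; exact: ipsi. Qed.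

Lemma weak_convergence_subsequence (F_ : nat -> cdf) F (psi : nat -> nat) :
  increasing_seq psi -> weak_convergence F_ F ->
  weak_convergence (fun k => F_ (psi k)) F.
Proof.
by move=> ipsi w h ch bh; exact: (cvg_subsequence ipsi (w h ch bh)).
Qed.

End SpectralPairs.

(** * Convergence criterion *)

Theorem theorem8 (R : realType) (tau : R) (tau_gt0 : 0 < tau)
    (F_ : nat -> cumulativeBounded (0 : R) (1 : R))
    (gamma_ : nat -> R) (G_ : nat -> R -> R)
    (F_spectral : forall n, spectral_pair tau (F_ n) (gamma_ n) (G_ n))
    (G_bounded : (limn_esup (fun n => total_variationR (G_ n)) < +oo)%E)
    (F : cumulativeBounded (0 : R) (1 : R)) (gamma : R) (G : R -> R)
    (Fspectral : spectral_pair tau F gamma G) :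
  (weak_convergence F_ F <->
     [/\ relatively_compact F_,
         gamma_ n @[n --> \oo] --> gamma &
         basic_convergence G_ G]) /\
  (weak_convergence F_ F ->
     limit_pinfty (G_ n) @[n --> \oo] --> limit_pinfty G).
Proof.
have G_fin n : (total_variationR (G_ n) < +oo)%E by have [[]] := F_spectral n.
have [C0 hC0] := limn_esup_bounded G_bounded G_fin.
have [m [mG mV FE]] := spectral_pair_data tau_gt0 Fspectral.
have [m_ m_P] := choice (fun n => spectral_pair_data tau_gt0 (F_spectral n)).
pose C := Num.max C0 (smass m).
have mC : smass m <= C by rewrite le_max lexx orbT.
have mC_ n : smass (m_ n) <= C.
  by have [_ h _] := m_P n; rewrite le_max (le_trans h).
have mG_ n : stieltjes_pair (m_ n) (G_ n) by have [] := m_P n.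
have FE_ n : has_exponent (F_ n) (expo_re (m_ n)) (expo_im tau (m_ n) (gamma_ n)).
  by have [] := m_P n.
have GlimE : limit_pinfty G = sint m (fun=> 1).
  by apply: limit_pinftyE => //; have [[]] := Fspectral.
have G_limE n : limit_pinfty (G_ n) = sint (m_ n) (fun=> 1).
  by apply: limit_pinftyE => //; have [[]] := F_spectral n.
have forward w := spectra_of_weak_convergence tau_gt0 mC_ mC FE_ FE w.
split; last first.
  move=> /forward[_ _ h]; rewrite GlimE.
  by under eq_fun do rewrite G_limE.
split => [w|[rc hg bc]].
- have [hg vc _] := forward w; split => //.
  + move=> phi iphi; exists id; first by [].
    by exists F; exact: weak_convergence_subsequence.
  + move=> phi iphi; apply: (@increments_of_vague _ (fun k => m_ (phi k)) m
      (fun k => G_ (phi k)) G C) => //.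
    by move=> N g cg; exact: (cvg_subsequence iphi (vc N g cg)).
- move=> h ch bh; apply: cvg_of_subsequences => phi iphi.
  (* a subsequence along which both the distribution functions and the
     increments of the spectral functions converge *)
  have [psi1 ipsi1 [F0 w]] := rc _ iphi.
  have i1 := increasing_seq_comp iphi ipsi1.
  have [psi2 ipsi2 [D cD GD]] := bc _ i1.
  have i2 := increasing_seq_comp i1 ipsi2.
  exists (fun k => psi1 (psi2 k)); first exact: increasing_seq_comp.
  have vc := vague_of_increments (fun k => mC_ (phi (psi1 (psi2 k))))
    (fun k => mG_ (phi (psi1 (psi2 k)))) mG cD GD.
  apply: (weak_convergence_of_spectra tau_gt0 (fun k => mC_ (phi (psi1 (psi2 k))))
    mC (fun k => FE_ (phi (psi1 (psi2 k)))) FE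
    (weak_convergence_subsequence ipsi2 w) (cvg_subsequence i2 hg) vc) => //.
Qed.
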